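(* For any $\varepsilon>0$ and $0<\eta<1/2$ the following holds for all sufficiently large $n$. Every $(n,d,\lambda)$-graph $G$ with $2048\lambda/\eta^2<d\leq \eta n^{1/2-\varepsilon}$ contains a $K_{(1-\eta)d}^{(\ell)}$-subdivision, where $\ell=2\lceil\log(\eta^2 n/4096)\rceil+5$ (natural logarithm).
   Context: An $(n,d,\lambda)$-graph is an $n$-vertex $d$-regular graph all of whose adjacency eigenvalues except the largest one are at most $\lambda$ in absolute value. A graph $G$ contains an $H$-subdivision if there is an injective map $\phi:V(H)\to V(G)$ and, for every edge $uv\in E(H)$, a path $P_{uv}$ in $G$ from $\phi(u)$ to $\phi(v)$, such that the paths $P_{uv}$ are pairwise internally vertex-disjoint (and their interiors avoid $\phi(V(H))$). An $H^{(\ell)}$-subdivision is an $H$-subdivision in which every path $P_{uv}$ has length exactly $\ell+1$. Floors are omitted ($K_{(1-\eta)d}$ means $K_{\lfloor(1-\eta)d\rfloor}$). *)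

(* Defs.v *)
From HB Require Import structures.
From mathcomp Require Import all_boot all_order all_algebra.
From mathcomp Require Import all_classical all_reals all_analysis.
Set Implicit Arguments. Unset Strict Implicit. Unset Printing Implicit Defensive.
Import Order.TTheory GRing.Theory Num.Theory.
Local Open Scope ring_scope.

Definition simple_graph (n : nat) (G : rel 'I_n) : Prop :=
  symmetric G /\ irreflexive G.

Definition d_regular (n : nat) (G : rel 'I_n) (d : nat) : Prop :=
  forall v : 'I_n, #|[set u | G v u]| = d.

Definition adj_mx (R : nzRingType) (n : nat) (G : rel 'I_n) : 'M[R]_n :=
  \matrix_(i, j) (G i j)%:R.

(* Eigenvalues with multiplicity = roots of the characteristic polynomial
   (the adjacency matrix is real symmetric so it splits over R).
   The condition says: the spectrum is mu :: s with mu the largest eigenvalue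
   and every other eigenvalue (with multiplicity) has absolute value <= lam. *)
Definition spectral_bound (R : realType) (n : nat) (A : 'M[R]_n) (lam : R) : Prop :=
  exists (mu : R) (s : seq R),
    char_poly A = ('X - mu%:P) * \prod_(x <- s) ('X - x%:P) /\
    (forall x, x \in s -> x <= mu) /\
    (forall x, x \in s -> `|x| <= lam).

Definition ndl_graph (R : realType) (n : nat) (G : rel 'I_n) (d : nat) (lam : R) : Prop :=
  simple_graph G /\ d_regular G d /\ spectral_bound (adj_mx R G) lam.

Definition has_Kl_subdivision (n : nat) (G : rel 'I_n) (m l : nat) : Prop :=
  exists (phi : 'I_m -> 'I_n) (P : 'I_m -> 'I_m -> seq 'I_n),
    injective phi /\
    (forall i j : 'I_m, (i < j)%N ->
       [/\ size (P i j) = l,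
           path G (phi i) (rcons (P i j) (phi j)),
           uniq (P i j) &
           forall x, x \in P i j -> x \notin codom phi]) /\
    (forall i j i' j' : 'I_m, (i < j)%N -> (i' < j')%N -> (i, j) != (i', j') ->
       [disjoint P i j & P i' j']).

(* Main.v *)
(** By the expander mixing lemma every set with many more vertices than
    [lam n / d] meets every other such set in an edge, and small sets expand by a
    factor 64 even after deleting few neighbours at each vertex. First take [d]
    disjoint stars with almost [d] leaves each, chosen greedily outside the closure
    of the previous ones. Let [C] be the closure of their union: vertices outside
    [C] have few neighbours in [C], and so do all but a tiny proportion of the
    leaves. Hence [(1 - eta) d] stars keep [(1 - eta) d] good leaves. The good
    leaves are then paired up and linked one pair at a time through the complement
    [W] of [C]. From both leaves one grows, by a Friedman-Pippenger argument, a
    path followed by a 4-ary tree until the last levels are so large that they are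
    joined by an edge; all arcs but those of the resulting path are then discarded,
    which preserves extendability. As [4^k >= e^k], depths [k + 1] and [k + 2] with
    [k = ceil (ln (eta^2 n / 4096))] suffice, and the total number of vertices used
    is [O(d^2 log n) = o(n)] plus the size of two trees. *)

From mathcomp Require Import all_boot.
From mathcomp Require Import zify.
Set Implicit Arguments. Unset Strict Implicit. Unset Printing Implicit Defensive.

(** * Extending forests with arc sets (Friedman-Pippenger) *)

Definition nbhd (T : finType) (G : rel T) (W X : {set T}) : {set T} :=
  [set w in W | [exists x in X, G x w]].

Definition targets (T : finType) (F : {set T * T}) : {set T} := [set a.2 | a in F].

Definition arcs_from (T : finType) (F : {set T * T}) (X : {set T}) : {set T * T} :=
  [set a in F | a.1 \in X].

(* Every vertex is promised [D] children, of which [arcs_from F X] counts those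
   already chosen for vertices of [X]. *)
Definition supply (T : finType) (G : rel T) (W : {set T}) (F : {set T * T}) (X : {set T}) : nat :=
  #|nbhd G W X :\: targets F| + #|arcs_from F X|.

(** The Hall-type condition of Friedman and Pippenger. [Q] is kept apart from the target set [W]
    because roots lie outside [W] but also need children. *)
Definition extendable (T : finType) (G : rel T) (W Q : {set T}) (D m : nat) (F : {set T * T}) :=
  forall X : {set T}, X \subset Q -> #|X| <= m -> D * #|X| <= supply G W F X.

Lemma nbhdP (T : finType) (G : rel T) (W X : {set T}) w :
  reflect (w \in W /\ exists2 x, x \in X & G x w) (w \in nbhd G W X).
Proof.
rewrite inE; apply: (iffP andP) => -[wW].
  by move=> /exists_inP h; split.
by move=> h; split=> //; apply/exists_inP.
Qed.

Lemma nbhdU (T : finType) (G : rel T) (W X Y : {set T}) :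
  nbhd G W (X :|: Y) = nbhd G W X :|: nbhd G W Y.
Proof.
apply/setP => w; rewrite [RHS]inE; apply/idP/idP.
  move=> /nbhdP[wW [x]]; rewrite inE => /orP[xX|xY] Gxw; apply/orP.
    by left; apply/nbhdP; split=> //; exists x.
  by right; apply/nbhdP; split=> //; exists x.
by case/orP => /nbhdP[wW [x xX Gxw]]; apply/nbhdP; split=> //; exists x => //; rewrite inE xX ?orbT.
Qed.

Lemma nbhdS (T : finType) (G : rel T) (W X Y : {set T}) :
  X \subset Y -> nbhd G W X \subset nbhd G W Y.
Proof. by move=> /setUidPr <-; rewrite nbhdU subsetUl. Qed.

(** Arc counts are modular, and a neighbour of the intersection is a common neighbour of both
    sets. *)
Lemma supply_submodular (T : finType) (G : rel T) W F (X Y : {set T}) :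
  supply G W F (X :|: Y) + supply G W F (X :&: Y) <= supply G W F X + supply G W F Y.
Proof.
rewrite /supply.
have -> : arcs_from F (X :|: Y) = arcs_from F X :|: arcs_from F Y.
  by apply/setP => a; rewrite !inE; case: (a \in F).
have -> : arcs_from F (X :&: Y) = arcs_from F X :&: arcs_from F Y.
  by apply/setP => a; rewrite !inE; case: (a \in F) => //=; rewrite andbF.
rewrite nbhdU setDUl.
have /subset_leq_card : nbhd G W (X :&: Y) :\: targets F \subset
    (nbhd G W X :\: targets F) :&: (nbhd G W Y :\: targets F).
  by rewrite subsetI !setSD ?nbhdS ?subsetIl ?subsetIr.
have := cardsUI (nbhd G W X :\: targets F) (nbhd G W Y :\: targets F).
have := cardsUI (arcs_from F X) (arcs_from F Y).
clear; lia.
Qed.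

Lemma targetsU1 (T : finType) (F : {set T * T}) a : targets (a |: F) = a.2 |: targets F.
Proof. by rewrite /targets imsetU1. Qed.

Lemma card_arcs_from1 (T : finType) (F : {set T * T}) s w (X : {set T}) :
  w \notin targets F -> #|arcs_from ((s, w) |: F) X| = #|arcs_from F X| + (s \in X).
Proof.
move=> wF; have swF : (s, w) \notin arcs_from F X.
  by rewrite inE negb_and; apply/orP; left; apply: contra wF => h; apply/imsetP; exists (s, w).
have [sX|sX] := boolP (s \in X).
  have -> : arcs_from ((s, w) |: F) X = (s, w) |: arcs_from F X.
    by apply/setP => -[a b]; rewrite !inE andb_orl; case: eqP => //= -[-> _]; rewrite sX.
  by rewrite cardsU1 swF addnC.
rewrite addn0; apply: eq_card => -[a b]; rewrite !inE /=.
by rewrite andb_orl; case: eqP => //= -[-> _]; rewrite (negbTE sX) andbF.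
Qed.

(* The union of all tight sets avoiding [s] is tight by submodularity; if
   every candidate target were blocked by a tight set, adding [s] to this union
   would violate extendability. *)
Lemma extendable_add_arc (T : finType) (G : rel T) (W Q : {set T}) (D M : nat)
    (F : {set T * T}) (s : T) :
  extendable G W Q D (2 * M) F -> 0 < M ->
  (forall X : {set T}, X \subset Q -> M <= #|X| <= 2 * M -> D * #|X| + #|F| < #|nbhd G W X|) ->
  s \in Q -> #|arcs_from F [set s]| < D ->
  exists w, [/\ w \in W, G s w, w \notin targets F &
    extendable G W Q D (2 * M) ((s, w) |: F)].
Proof.
move=> extF M0 big sQ outs.
pose tight (X : {set T}) := [&& X \subset Q, #|X| < M & supply G W F X <= D * #|X|].
(* Between [M] and [2 * M] vertices the expansion [big] beats the at most [#|F|] used targets, so a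
   tight set stays below [M]. Hence a union of two tight sets is small enough to be tight again. *)
have small (X : {set T}) : X \subset Q -> #|X| <= 2 * M -> supply G W F X <= D * #|X| -> tight X.
  move=> XQ Xm sX; apply/and3P; split=> //; rewrite ltnNge; apply/negP => MX.
  have := big X XQ; rewrite MX Xm => /(_ isT).
  have : #|targets F| <= #|F| by apply: leq_imset_card.
  have := cardsID (targets F) (nbhd G W X).
  have := subset_leq_card (subsetIr (nbhd G W X) (targets F)).
  move: sX; rewrite /supply; clear; lia.
have tightU (X Y : {set T}) : tight X -> tight Y -> tight (X :|: Y).
  move=> /and3P[XQ XM sX] /and3P[YQ YM sY].
  have cUI := cardsUI X Y.
  have UQ : X :|: Y \subset Q by rewrite subUset XQ.
  have IQ : X :&: Y \subset Q by apply: subset_trans (subsetIl _ _) XQ.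
  have sub := supply_submodular G W F X Y.
  have ext := extF _ IQ.
  apply: small => //; first by move: XM YM cUI; clear; lia.
  have : D * #|X :&: Y| <= supply G W F (X :&: Y) by apply: ext; move: XM YM cUI; clear; lia.
  move: sX sY sub cUI; clear; nia.
pose Z := \bigcup_(X | tight X && (s \notin X)) X.
have /andP[Zt sZ] : tight Z && (s \notin Z).
  rewrite /Z; elim/big_ind: _ => //.
    rewrite inE andbT; apply: small; rewrite ?sub0set ?cards0 //.
    rewrite /supply; have -> : nbhd G W set0 = set0.
      by apply/setP => w; rewrite [RHS]inE; apply/nbhdP => -[_ [x]]; rewrite inE.
    by rewrite set0D cards0 add0n muln0 leqn0 cards_eq0; apply/eqP/setP => a; rewrite !inE andbF.
  move=> X Y /andP[tX sX] /andP[tY sY]; rewrite tightU //=.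
  by rewrite inE negb_or sX.
have [/existsP[w /andP[wc /forallP/= wP]]|/existsPn noW] :=
  boolP [exists w, (w \in nbhd G W [set s] :\: targets F) &&
     [forall X : {set T}, (tight X && (s \notin X)) ==> (w \notin nbhd G W X)]].
  move: wc; rewrite inE => /andP[wF /nbhdP[wW [s']]]; rewrite inE => /eqP-> Gsw.
  exists w; split=> // X XQ Xm; rewrite /supply targetsU1 /= card_arcs_from1 //.
  have dec : #|nbhd G W X :\: targets F| <= #|nbhd G W X :\: (w |: targets F)| + (w \in nbhd G W X).
    rewrite (cardsD1 w (nbhd G W X :\: targets F)) addnC inE wF /= leq_add2r.
    apply: subset_leq_card; apply/subsetP => v; rewrite !inE negb_or.
    by move=> /andP[-> /andP[-> ->]].
  have := extF X XQ Xm; rewrite {1}/supply => eX.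
  move: dec eX; set n1 := #|_ :\: targets F|; set n2 := #|_ :\: (w |: _)|.
  set n3 := #|arcs_from F X| => dec eX.
  (* Only sets with [w] among their neighbours lose supply, and they lose one. Either [s] is in [X]
     and the new arc repays it, or [X] is not tight, as [w] is unblocked, and has one to spare. *)
  case wX : (w \in nbhd G W X) dec => /= dec; last by move: dec eX; clear; lia.
  case sX : (s \in X) => /=; first by move: dec eX; clear; lia.
  have := wP X; rewrite wX sX /= implybF andbT => /negP tX.
  have : ~ supply G W F X <= D * #|X| by move=> h; apply: tX; apply: small.
  rewrite /supply -/n1 -/n3; move: dec; clear; lia.
exfalso; have /and3P[ZQ ZM sZt] := Zt.
have /(extF (s |: Z)) : s |: Z \subset Q by rewrite subUset sub1set sQ.
have cZ : #|s |: Z| = #|Z|.+1 by rewrite cardsU1 sZ.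
rewrite cZ => ext.
(* Each free neighbour of [s] is blocked by a tight set inside [Z], so [s] adds no free neighbour,
   only its fewer than [D] arcs, while the demand grows by [D]. *)
have : supply G W F (s |: Z) <= supply G W F Z + #|arcs_from F [set s]|.
  rewrite /supply -addnA leq_add //.
    apply: subset_leq_card; rewrite nbhdU setDUl subUset subxx andbT.
    apply/subsetP => w wc; have := noW w; rewrite wc /= => /forallPn[X].
    rewrite negb_imply negbK => /andP[tX wX].
    rewrite inE; move: wc; rewrite inE => /andP[-> _] /=.
    by apply: (subsetP (nbhdS G W _)) wX; apply: (bigcup_sup X).
  have -> : arcs_from F (s |: Z) = arcs_from F Z :|: arcs_from F [set s].
    by apply/setP => a; rewrite !inE; case: (a \in F) => //=; rewrite orbC.
  exact: leq_card_setU.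
have : #|Z|.+1 <= 2 * M by move: ZM M0; clear; lia.
move=> /ext; move: sZt outs; clear; lia.
Qed.

Definition valid_arcs (T : finType) (G : rel T) (W : {set T}) (F : {set T * T}) :=
  (forall a, a \in F -> G a.1 a.2 /\ a.2 \in W) /\ {in F &, injective snd}.

(** Targets of distinct arcs are distinct, so every arc removed from [X] frees its own neighbour of
    [X] and the supply does not drop. *)
Lemma extendable_subset (T : finType) (G : rel T) (W Q : {set T}) (D m : nat) (F F' : {set T * T}) :
  valid_arcs G W F -> F' \subset F -> extendable G W Q D m F -> extendable G W Q D m F'.
Proof.
move=> [FG Finj] F'F ext X XQ Xm; apply: leq_trans (ext X XQ Xm) _.
rewrite /supply.
pose H := arcs_from (F :\: F') X.
have cH : #|targets H| = #|H|.
  apply: card_in_imset => a b; rewrite !inE => /andP[/andP[_ aF] _] /andP[/andP[_ bF] _].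
  exact: Finj.
have cF : #|arcs_from F X| = #|arcs_from F' X| + #|H|.
  rewrite -(cardsID F' (arcs_from F X)); congr (_ + _); apply: eq_card => a.
    by rewrite !inE; case: (boolP (a \in F')) => [/(subsetP F'F)->|]; rewrite ?andbF ?andbT.
  by rewrite !inE; case: (a \in F') => //=; rewrite andbF.
rewrite cF [#|arcs_from F' X| + _]addnC addnA leq_add2r -cH.
have -> : #|nbhd G W X :\: targets F| + #|targets H| =
    #|(nbhd G W X :\: targets F) :|: targets H|.
  have := cardsUI (nbhd G W X :\: targets F) (targets H).
  have -> : (nbhd G W X :\: targets F) :&: targets H = set0.
    apply/setP => w; rewrite !inE; apply/negP => /andP[/andP[wF _] /imsetP[a aH wa]].
    case/negP: wF; apply/imsetP; exists a => //.
    by move: aH; rewrite !inE => /andP[/andP[_ ->]].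
  by rewrite cards0 addn0 => ->.
apply: subset_leq_card; apply/subsetP => w; rewrite in_setU => /orP[|].
  rewrite !in_setD => /andP[wF ->]; rewrite andbT; apply: contra wF.
  by move=> /imsetP[a aF' ->]; apply/imsetP; exists a => //; apply: (subsetP F'F).
move=> /imsetP[a]; rewrite !inE => /andP[/andP[aF' aF] aX] ->.
have [Ga aW] := FG a aF; apply/andP; split.
  apply: contra aF' => /imsetP[b bF' E].
  by rewrite (Finj a b) // (subsetP F'F).
by apply/andP; split=> //; apply/exists_inP; exists a.1.
Qed.

(** * Forests and their growth level by level *)

Definition arcrel (T : finType) (F : {set T * T}) : rel T := fun a b => (a, b) \in F.

(* [Rt] is the set of roots of the forest [F]; all its other vertices are targets. *)
Record forest (T : finType) (G : rel T) (W Q : {set T}) (D m : nat) (Rt : {set T})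
    (F : {set T * T}) : Prop := Forest {
  forest_valid : valid_arcs G W F;
  forest_ext : extendable G W Q D m F;
  forest_src : forall a, a \in F -> a.1 \in Rt :|: targets F }.

Lemma targetsP (T : finType) (F : {set T * T}) w :
  reflect (exists s, (s, w) \in F) (w \in targets F).
Proof.
apply: (iffP imsetP) => [[[s v] aF /= ->]|[s swF]]; first by exists s.
by exists (s, w).
Qed.

Lemma targetsS (T : finType) (F F' : {set T * T}) :
  F \subset F' -> targets F \subset targets F'.
Proof. exact: imsetS. Qed.

Lemma targets_sub (T : finType) (G : rel T) (W : {set T}) (F : {set T * T}) :
  valid_arcs G W F -> targets F \subset W.
Proof. by move=> [FG _]; apply/subsetP => w /targetsP[s /FG[]]. Qed.

Lemma arcs_from_notin (T : finType) (F : {set T * T}) x :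
  (forall a, a \in F -> a.1 != x) -> arcs_from F [set x] = set0.
Proof. by move=> h; apply/setP => a; rewrite !inE; case: (boolP (a \in F)) => // /h /negbTE. Qed.

(** [B] is an arc budget: as long as fewer than [B] arcs are present, no set of [M] to [2 * M]
    vertices can become tight. *)
Definition expands (T : finType) (G : rel T) (W Q : {set T}) (D M B : nat) :=
  forall X : {set T}, X \subset Q -> M <= #|X| <= 2 * M -> D * #|X| + B <= #|nbhd G W X|.

(** A vertex that occurs [r] times in [l] receives [r] children, so one list describes both path
    steps and branching steps. *)
Lemma grow_seq (T : finType) (G : rel T) (W Q : {set T}) (D M B : nat)
    (Rt : {set T}) (l : seq T) :
  forall F : {set T * T},
  0 < M -> expands G W Q D M B -> [disjoint Rt & W] ->
  forest G W Q D (2 * M) Rt F ->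
  {subset l <= Q} -> (forall a, a \in l -> a \in Rt :|: targets F) ->
  (forall a, a \in l -> #|arcs_from F [set a]| + count_mem a l <= D) ->
  #|F| + size l <= B ->
  exists (F' : {set T * T}) (l' : seq T), [/\ forest G W Q D (2 * M) Rt F',
    F \subset F', #|F'| = #|F| + size l,
    (forall a, a \in F' -> a \in F \/ a.1 \in l) &
    [/\ size l' = size l, uniq l' & forall w, w \in l' -> w \notin targets F /\
      exists2 a, a \in l & (a, w) \in F']].
Proof.
elim: l => [|s l IH] F M0 ex RW fF lQ lR lD FB.
  by exists F, [::]; split=> //; [rewrite addn0|left].
have [FG Fi] := forest_valid fF.
have /(_ M0) := @extendable_add_arc T G W Q D M F s (forest_ext fF).
case.
- move=> X XQ XM; apply: leq_trans (ex X XQ XM); rewrite -addnS leq_add2l.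
  by apply: leq_trans FB; rewrite /= addnS ltnS leq_addr.
- by apply: lQ; rewrite mem_head.
- by have := lD s (mem_head _ _); rewrite /= eqxx; lia.
move=> w [wW Gsw wF extw].
set F1 := (s, w) |: F.
have swF : (s, w) \notin F by apply: contra wF => h; apply/targetsP; exists s.
have cF1 : #|F1| = #|F|.+1 by rewrite cardsU1 swF.
have FF1 : F \subset F1 by apply: subsetUr.
have fF1 : forest G W Q D (2 * M) Rt F1.
  split=> //.
  - split; first by move=> a; rewrite !inE => /orP[/eqP->//|/FG].
    move=> a b; rewrite !inE => /orP[/eqP->|aF] /orP[/eqP->|bF] //= E.
    + by case/negP: wF; apply/targetsP; exists b.1; rewrite E -surjective_pairing.
    + by case/negP: wF; apply/targetsP; exists a.1; rewrite -E -surjective_pairing.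
    + exact: Fi.
  - move=> a; rewrite in_setU1 => /orP[/eqP->/=|/(forest_src fF)].
      apply: (subsetP _ _ (lR s (mem_head _ _))).
      by apply: setUS; apply: targetsS.
    by apply: (subsetP); apply: setUS; apply: targetsS.
have wR : w \notin Rt by apply: contraTN wW => h; have /disjointFr -> := RW.
have [||||F' [l' [fF' F1F' cF' src [sl' ul' l'P]]]] := IH F1 M0 ex RW fF1.
- by move=> a al; apply: lQ; rewrite inE al orbT.
- move=> a al; have : a \in Rt :|: targets F by apply: lR; rewrite inE al orbT.
  by apply: (subsetP); apply: setUS; apply: targetsS.
- move=> a al; rewrite card_arcs_from1 // inE.
  have := lD a; rewrite inE al orbT => /(_ isT) /=.
  by rewrite addnA.
- by rewrite cF1 addSnnS.
exists F', (w :: l'); split=> //.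
- exact: subset_trans F1F'.
- by rewrite cF' cF1 addSnnS.
- move=> a /src[|al]; last by right; rewrite inE al orbT.
  by rewrite in_setU1 => /orP[/eqP->|]; [right; rewrite mem_head|left].
split; first by rewrite /= sl'.
  rewrite /= ul' andbT; apply/negP => /l'P[/negP[]].
  by rewrite targetsU1 setU11.
move=> v; rewrite inE => /orP[/eqP->|/l'P[vF1 [a al avF']]].
  by split=> //; exists s; rewrite ?mem_head // (subsetP F1F') // setU11.
split; last by exists a => //; rewrite inE al orbT.
by apply: contra vF1; apply: (subsetP); apply: targetsS.
Qed.

(** Excluding the targets of [F0] makes the branch avoid everything built before its root was
    activated, which later gives disjointness of the paths. *)
Definition reach (T : finType) (F0 F : {set T * T}) (x : T) (n : nat) (v : T) :=
  exists p, [/\ size p = n, path (arcrel F) x p, last x p = v, uniq p &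
    {subset p <= targets F :\: targets F0}].

Lemma reach_step (T : finType) (F0 F F' : {set T * T}) (x : T) n v w :
  F0 \subset F -> F \subset F' -> reach F0 F x n v -> (v, w) \in F' ->
  w \notin targets F -> reach F0 F' x n.+1 w.
Proof.
move=> F0F FF' [p [sp px lp up pF]] vw wF; exists (rcons p w); split.
- by rewrite size_rcons sp.
- rewrite rcons_path lp /arcrel vw andbT.
  by apply: sub_path px => a b; apply: (subsetP FF').
- by rewrite last_rcons.
- rewrite rcons_uniq up andbT; apply: contra wF => /pF.
  by rewrite inE => /andP[].
move=> u; rewrite mem_rcons inE => /orP[/eqP->|/pF]; rewrite !in_setD.
  apply/andP; split; last by apply/targetsP; exists v.
  by apply: contra wF; apply: (subsetP); apply: targetsS.
by move=> /andP[-> uF] /=; apply: (subsetP (targetsS FF')).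
Qed.

(* The state of a tree grown from the root [x] after the arcs of [F0]: a level
   [L] of vertices at depth [n], none of which has children yet. *)
Record level (T : finType) (Q Rt : {set T}) (F0 F : {set T * T}) (x : T) (n : nat)
    (L : seq T) : Prop := Level {
  level_uniq : uniq L;
  level_sub : {subset L <= Q};
  level_in : forall a, a \in L -> a \in Rt :|: targets F;
  level_out : forall a b, a \in F -> b \in L -> a.1 != b;
  level_reach : forall a, a \in L -> reach F0 F x n a }.

Lemma count_flatten_nseq (T : eqType) (r : nat) (L : seq T) a :
  count_mem a (flatten [seq nseq r b | b <- L]) = r * count_mem a L.
Proof.
elim: L => [|b L IH] /=; first by rewrite muln0.
by rewrite count_cat count_nseq IH mulnDr mulnC.
Qed.

Lemma size_flatten_nseq (T : eqType) (r : nat) (L : seq T) :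
  size (flatten [seq nseq r b | b <- L]) = r * size L.
Proof. by elim: L => [|b L IH] /=; rewrite ?muln0 // size_cat size_nseq IH mulnS. Qed.

Lemma mem_flatten_nseq (T : eqType) (r : nat) (L : seq T) a :
  a \in flatten [seq nseq r b | b <- L] -> a \in L.
Proof.
elim: L => //= b L IH; rewrite mem_cat mem_nseq inE => /orP[/andP[_ ->]//|/IH->].
by rewrite orbT.
Qed.

Lemma grow_level (T : finType) (G : rel T) (W Q : {set T}) (D M B : nat)
    (Rt : {set T}) (F0 F : {set T * T}) x n L r :
  0 < M -> expands G W Q D M B -> [disjoint Rt & W] -> W \subset Q -> r <= D ->
  forest G W Q D (2 * M) Rt F -> F0 \subset F -> level Q Rt F0 F x n L ->
  #|F| + r * size L <= B ->
  exists (F' : {set T * T}) (L' : seq T), [/\ forest G W Q D (2 * M) Rt F',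
    F \subset F', #|F'| = #|F| + r * size L, size L' = r * size L &
    level Q Rt F0 F' x n.+1 L'].
Proof.
move=> M0 ex RW WQ rD fF F0F lv FB.
have [||||F' [L' [fF' FF' cF' src [sL' uL' L'P]]]] :=
    @grow_seq T G W Q D M B Rt (flatten [seq nseq r b | b <- L]) F M0 ex RW fF.
- by move=> a /mem_flatten_nseq aL; apply: (level_sub lv aL).
- by move=> a /mem_flatten_nseq aL; apply: (level_in lv aL).
- move=> a /mem_flatten_nseq aL; rewrite count_flatten_nseq.
  rewrite arcs_from_notin ?cards0; last by move=> b bF; apply: (level_out lv bF aL).
  by rewrite count_uniq_mem ?(level_uniq lv) // aL muln1.
- by rewrite size_flatten_nseq.
rewrite size_flatten_nseq in cF' sL'.
have tW := targets_sub (forest_valid fF').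
have L't w : w \in L' -> w \in targets F'.
  by move=> /L'P[_ [a _ aw]]; apply/targetsP; exists a.
exists F', L'; split=> //.
split=> //.
- by move=> a /L't /(subsetP tW) /(subsetP WQ).
- by move=> a /L't aF; rewrite inE aF orbT.
(* Every source is a root or an old target, whereas the vertices of the new level are new targets in
   [W], which is disjoint from the roots. *)
- move=> a b aF bL'; apply/negP => /eqP ab.
  have [bF _] := L'P b bL'.
  have : b \in Rt :|: targets F.
    have [aF0|aL] := src a aF; first by rewrite -ab (forest_src fF).
    by rewrite -ab; exact: (level_in lv (mem_flatten_nseq aL)).
  rewrite inE (negbTE bF) orbF => bR.
  by have := subsetP tW b (L't b bL'); rewrite (disjointFr RW bR).
move=> w wL'; have [wF [a aL aw]] := L'P w wL'.
by apply: reach_step (level_reach lv (mem_flatten_nseq aL)) aw wF.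
Qed.

Lemma grow_path (T : finType) (G : rel T) (W Q : {set T}) (D M B : nat)
    (Rt : {set T}) (F0 : {set T * T}) x i :
  0 < M -> expands G W Q D M B -> [disjoint Rt & W] -> W \subset Q -> 0 < D ->
  forall F n L,
  forest G W Q D (2 * M) Rt F -> F0 \subset F -> level Q Rt F0 F x n L ->
  #|F| + i * size L <= B ->
  exists (F' : {set T * T}) (L' : seq T), [/\ forest G W Q D (2 * M) Rt F',
    F \subset F', #|F'| = #|F| + i * size L, size L' = size L &
    level Q Rt F0 F' x (n + i) L'].
Proof.
move=> M0 ex RW WQ D0; elim: i => [|i IH] F n L fF F0F lv FB.
  by exists F, L; split; rewrite ?addn0.
have [|F1 [L1 [fF1 FF1 cF1 sL1 lv1]]] := grow_level M0 ex RW WQ D0 fF F0F lv.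
  by rewrite mul1n; move: FB; rewrite mulSn; lia.
have F0F1 := subset_trans F0F FF1.
rewrite mul1n in sL1 cF1; rewrite mulSn in FB.
have [|F' [L' [fF' FF' cF' sL' lv']]] := IH F1 n.+1 L1 fF1 F0F1 lv1.
  by rewrite sL1 cF1; lia.
exists F', L'; split=> //.
- exact: subset_trans FF'.
- by rewrite cF' sL1 cF1 mulSn; lia.
- by rewrite sL'.
by rewrite addnS -addSn.
Qed.

(** The geometric sum of the level sizes is [4 * size L * (4 ^ j - 1) / 3]; the arc count is stated
    three times over to avoid division and subtraction. *)
Lemma grow_tree (T : finType) (G : rel T) (W Q : {set T}) (M B : nat)
    (Rt : {set T}) (F0 : {set T * T}) x j :
  0 < M -> expands G W Q 4 M B -> [disjoint Rt & W] -> W \subset Q ->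
  forall F n L,
  forest G W Q 4 (2 * M) Rt F -> F0 \subset F -> level Q Rt F0 F x n L ->
  3 * #|F| + 4 * size L * 4 ^ j <= 3 * B + 4 * size L ->
  exists (F' : {set T * T}) (L' : seq T), [/\ forest G W Q 4 (2 * M) Rt F',
    F \subset F', 3 * #|F'| + 4 * size L = 3 * #|F| + 4 * size L * 4 ^ j,
    size L' = size L * 4 ^ j & level Q Rt F0 F' x (n + j) L'].
Proof.
move=> M0 ex RW WQ; elim: j => [|j IH] F n L fF F0F lv FB.
  by exists F, L; split; rewrite ?addn0 ?expn0 ?muln1.
have j0 : 0 < 4 ^ j by rewrite expn_gt0.
rewrite expnS in FB *.
have [|F1 [L1 [fF1 FF1 cF1 sL1 lv1]]] := grow_level M0 ex RW WQ (leqnn 4) fF F0F lv.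
  by nia.
have F0F1 := subset_trans F0F FF1.
have [|F' [L' [fF' FF' cF' sL' lv']]] := IH F1 n.+1 L1 fF1 F0F1 lv1.
  by rewrite sL1 cF1; nia.
exists F', L'; split=> //.
- exact: subset_trans FF'.
- by move: cF'; rewrite sL1 cF1; nia.
- by rewrite sL' sL1; nia.
by rewrite addnS -addSn.
Qed.

(** * Linking pairs of roots by paths of prescribed length *)

Definition path_arcs (T : Type) (x : T) (p : seq T) : seq (T * T) := pairmap pair x p.

Lemma path_arcs_sub (T : finType) (F : {set T * T}) p : forall x,
  path (arcrel F) x p -> {subset path_arcs x p <= F}.
Proof.
elim: p => //= y p IH x /andP[xy yp] a; rewrite inE => /orP[/eqP->//|].
exact: IH.
Qed.

Lemma path_arcs_target (T : finType) (p : seq T) v : forall x,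
  v \in p -> exists s, (s, v) \in path_arcs x p.
Proof.
elim: p => //= y p IH x; rewrite inE => /orP[/eqP->|/(IH y)[s h]].
  by exists x; rewrite mem_head.
by exists s; rewrite inE h orbT.
Qed.

Lemma path_arcs_source (T : finType) (p : seq T) a : forall x,
  a \in path_arcs x p -> a.1 \in x :: p.
Proof.
elim: p => //= y p IH x; rewrite inE => /orP[/eqP->|/IH]; first by rewrite mem_head.
by rewrite inE => /orP[/eqP->|h]; rewrite !inE ?eqxx ?h ?orbT.
Qed.

Lemma size_path_arcs (T : finType) (p : seq T) x : size (path_arcs x p) = size p.
Proof. exact: size_pairmap. Qed.

Lemma level_root (T : finType) (Q Rt : {set T}) (F : {set T * T}) x :
  x \in Q -> x \in Rt -> (forall a, a \in F -> a.1 != x) -> level Q Rt F F x 0 [:: x].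
Proof.
move=> xQ xR xF; split=> //.
- by move=> a; rewrite inE => /eqP->.
- by move=> a; rewrite inE => /eqP->; rewrite inE xR.
- by move=> a b aF; rewrite inE => /eqP->; apply: xF.
by move=> a; rewrite inE => /eqP->; exists [::].
Qed.

Lemma forestR (T : finType) (G : rel T) (W Q : {set T}) D m (Rt Rt' : {set T})
    (F : {set T * T}) :
  Rt \subset Rt' -> forest G W Q D m Rt F -> forest G W Q D m Rt' F.
Proof.
move=> RR [v e s]; split=> // a /s; apply: (subsetP); exact: setSU.
Qed.

(** The half at [y] is grown on top of the half at [x], so the two are disjoint. Each tree costs
    less than [4 / 3 * 4 ^ j] arcs, whence the term [4 * 4 ^ j], but this cost is temporary: only
    the arcs of the path survive in [F']. *)
Lemma connect_roots (T : finType) (G : rel T) (W Q : {set T}) (M B : nat)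
    (Rt : {set T}) (F : {set T * T}) x y i1 i2 j :
  symmetric G -> 0 < M -> expands G W Q 4 M B -> [disjoint Rt & W] -> W \subset Q ->
  (forall A A' : {set T}, 4 ^ j <= #|A| -> 4 ^ j <= #|A'| ->
    exists a b, [/\ a \in A, b \in A' & G a b]) ->
  forest G W Q 4 (2 * M) Rt F ->
  x \in Q -> y \in Q -> x \notin W -> y \notin W -> x \notin Rt -> y \notin Rt -> x != y ->
  #|F| + i1 + i2 + 4 * 4 ^ j <= B ->
  exists F' p, [/\ forest G W Q 4 (2 * M) (x |: (y |: Rt)) F', F \subset F',
    #|F'| <= #|F| + (i1 + i2 + 2 * j),
    size p = i1 + i2 + 2 * j &
    [/\ path G x (rcons p y), uniq p & {subset p <= targets F' :\: targets F}]].
Proof.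
move=> Gs M0 ex RW WQ joint fF xQ yQ xW yW xR yR xy FB.
set Rt' := x |: (y |: Rt); set f := #|F| in FB *; set N := 4 ^ j in FB joint.
have j0 : 0 < 4 ^ j by rewrite expn_gt0.
have RW' : [disjoint Rt' & W].
  rewrite disjoint_subset; apply/subsetP => v; rewrite !inE.
  by move=> /orP[/eqP->|/orP[/eqP->|/(disjointFr RW)->]].
have RxR' : x |: Rt \subset Rt' by apply: setUS; apply: subsetUr.
have RWx : [disjoint x |: Rt & W] := disjointWl RxR' RW'.
have fF' : forest G W Q 4 (2 * M) (x |: Rt) F := forestR (subsetUr _ _) fF.
have src0 v : v \notin W -> v \notin Rt -> forall a, a \in F -> a.1 != v.
  move=> vW vR a aF; apply: contraNneq vW => av.
  have := forest_src fF aF; rewrite av inE (negbTE vR) /=.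
  exact: (subsetP (targets_sub (forest_valid fF))).
have yR' : y \in Rt' by rewrite !inE eqxx orbT.
have [||F1 [L1 [fF1 FF1 cF1 sL1 lv1]]] :=
  @grow_path T G W Q 4 M B (x |: Rt) F x i1 M0 ex RWx WQ isT
    F 0 [:: x] fF' (subxx _).
- by apply: level_root; rewrite ?setU11 //; apply: src0.
- by rewrite -/f /= muln1; clear -FB; lia.
have E1 : #|F1| = f + i1 by rewrite cF1 muln1.
have [|F2 [L2 [fF2 FF2 cF2 sL2 lv2]]] := grow_tree (j := j) M0 ex RWx WQ fF1 FF1 lv1.
  by rewrite sL1 E1 -/N /=; clear -FB; lia.
have E2 : 3 * #|F2| + 4 = 3 * (f + i1) + 4 * N by move: cF2; rewrite sL1 E1.
have FF2' := subset_trans FF1 FF2.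
(* The first growth has root set [x |: Rt], without [y]; since [y] is outside [W] as well, it cannot
   have children yet. *)
have yF2 a : a \in F2 -> a.1 != y.
  move=> aF; apply: contraNneq yW => ay.
  have := forest_src fF2 aF; rewrite ay !inE eq_sym (negbTE xy) (negbTE yR) /=.
  exact: (subsetP (targets_sub (forest_valid fF2))).
have fF2' := forestR RxR' fF2.
have [||F3 [L3 [fF3 FF3 cF3 sL3 lv3]]] :=
  @grow_path T G W Q 4 M B Rt' F2 y i2 M0 ex RW' WQ isT
    F2 0 [:: y] fF2' (subxx _).
- exact: level_root.
- by move: E2; rewrite /= muln1; set f2 := #|F2|; clear -FB; lia.
have E3 : #|F3| = #|F2| + i2 by rewrite cF3 muln1.
have [|F4 [L4 [fF4 FF4 cF4 sL4 lv4]]] := grow_tree (j := j) M0 ex RW' WQ fF3 FF3 lv3.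
  by move: E2; rewrite sL3 E3 -/N /=; set f2 := #|F2|; clear -FB; lia.
have F24 := subset_trans FF3 FF4.
have F04 := subset_trans FF2' F24.
rewrite sL1 mul1n in sL2; rewrite sL3 mul1n in sL4.
have [||a [b]] := joint [set z in L2] [set z in L4].
- by rewrite cardsE (card_uniqP (level_uniq lv2)) sL2.
- by rewrite cardsE (card_uniqP (level_uniq lv4)) sL4.
rewrite !inE => -[aL bL Gab].
have [pa [spa ppa la upa paF]] := level_reach lv2 aL.
have [pb [spb ppb lb upb pbF]] := level_reach lv4 bL.
have pa4 : path (arcrel F4) x pa by apply: sub_path ppa => u v; apply: (subsetP F24).
(* The arcs of the two branches that end in the joining edge; all other tree arcs are dropped. *)
pose H := [set z in path_arcs x pa ++ path_arcs y pb].
have HF : H \subset F4.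
  apply/subsetP => z; rewrite inE mem_cat => /orP[].
    exact: path_arcs_sub pa4 z.
  exact: path_arcs_sub ppb z.
have F'F : F :|: H \subset F4 by rewrite subUset F04 HF.
have [FG Fi] := forest_valid fF4.
have paT : {subset pa <= targets (F :|: H)}.
  move=> v vp; have [s sv] := path_arcs_target x vp.
  by apply/targetsP; exists s; rewrite !inE mem_cat sv orbT.
have pbT : {subset pb <= targets (F :|: H)}.
  move=> v vp; have [s sv] := path_arcs_target y vp.
  by apply/targetsP; exists s; rewrite !inE mem_cat sv !orbT.
exists (F :|: H), (pa ++ rev pb); rewrite /f; split.
- split; last first.
  + move=> z; rewrite !inE mem_cat => /orP[zF|].
      have := forest_src fF zF; rewrite !inE => /orP[->|h]; first by rewrite !orbT.
      by apply/orP; right; apply: (subsetP (targetsS (subsetUl F H))).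
    case/orP => /path_arcs_source; rewrite inE => /orP[/eqP->|].
    * by rewrite eqxx.
    * by move=> /paT ->; rewrite orbT.
    * by rewrite eqxx orbT.
    * by move=> /pbT ->; rewrite orbT.
  + exact: extendable_subset (forest_valid fF4) F'F (forest_ext fF4).
  split; first by move=> z /(subsetP F'F) /FG.
  by move=> z z' /(subsetP F'F) zF /(subsetP F'F); apply: Fi.
- exact: subsetUl.
- apply: leq_trans (leq_card_setU _ _) _; rewrite leq_add2l.
  rewrite /H cardsE; apply: leq_trans (card_size _) _.
  by rewrite size_cat !size_path_arcs spa spb; clear; lia.
- by rewrite size_cat size_rev spa spb; clear; lia.
have aG p z : path (arcrel F4) z p -> path G z p.
  by apply: sub_path => u v /FG[].
split.
- rewrite rcons_cat cat_path aG //= la -rev_cons lastI lb rev_rcons /= Gab /=.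
  rewrite -lb rev_path; apply: sub_path (aG _ _ ppb) => u v /=.
  by rewrite Gs.
- rewrite cat_uniq upa rev_uniq upb andbT /=; apply/hasPn => v; rewrite mem_rev => /pbF.
  rewrite inE => /andP[vF2 _]; apply: contra vF2 => /paF.
  by rewrite inE => /andP[].
move=> v; rewrite mem_cat mem_rev inE => /orP[vp|vp].
  by rewrite paT //; have := paF v vp; rewrite inE => /andP[-> _].
rewrite pbT // andbT; have := pbF v vp; rewrite inE => /andP[h _].
by apply: contra h; apply: (subsetP (targetsS FF2')).
Qed.

Lemma forest0 (T : finType) (G : rel T) (W Q : {set T}) D m :
  (forall X : {set T}, X \subset Q -> #|X| <= m -> D * #|X| <= #|nbhd G W X|) ->
  forest G W Q D m set0 set0.
Proof.
move=> h; split; first by split=> a; rewrite inE.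
  move=> X XQ Xm; rewrite /supply /targets imset0 setD0.
  by apply: leq_trans (h X XQ Xm) _; rewrite leq_addr.
by move=> a; rewrite inE.
Qed.

(** The first budget term counts the arcs of finished paths, which are kept. The second pays for the
    two trees of the current pair, whose room is reused by the next pair. *)
Lemma linkage (T : finType) (G : rel T) (W Q : {set T}) (M B i1 i2 j : nat)
    (ps : seq (T * T)) :
  symmetric G -> 0 < M -> expands G W Q 4 M B -> W \subset Q ->
  (forall X : {set T}, X \subset Q -> #|X| <= 2 * M -> 4 * #|X| <= #|nbhd G W X|) ->
  (forall A A' : {set T}, 4 ^ j <= #|A| -> 4 ^ j <= #|A'| ->
    exists a b, [/\ a \in A, b \in A' & G a b]) ->
  uniq (unzip1 ps ++ unzip2 ps) ->
  (forall z, z \in unzip1 ps ++ unzip2 ps -> z \in Q :\: W) ->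
  size ps * (i1 + i2 + 2 * j) + (i1 + i2 + 4 * 4 ^ j) <= B ->
  exists P : T * T -> seq T,
    (forall q, q \in ps -> [/\ size (P q) = i1 + i2 + 2 * j, path G q.1 (rcons (P q) q.2),
       uniq (P q) & {subset P q <= W}]) /\
    (forall q q', q \in ps -> q' \in ps -> q != q' -> [disjoint P q & P q']).
Proof.
move=> Gs M0 ex WQ ex0 joint.
(* The induction carries the forest itself: old paths lie inside its targets, and a new path uses
   only new targets. *)
suff H : uniq (unzip1 ps ++ unzip2 ps) ->
  (forall z, z \in unzip1 ps ++ unzip2 ps -> z \in Q :\: W) ->
  size ps * (i1 + i2 + 2 * j) + (i1 + i2 + 4 * 4 ^ j) <= B ->
  exists (F : {set T * T}) (P : T * T -> seq T),
  [/\ forest G W Q 4 (2 * M) [set z in unzip1 ps ++ unzip2 ps] F,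
      #|F| <= size ps * (i1 + i2 + 2 * j),
    (forall q, q \in ps -> [/\ size (P q) = i1 + i2 + 2 * j, path G q.1 (rcons (P q) q.2),
       uniq (P q) & {subset P q <= targets F}]) &
    (forall q q', q \in ps -> q' \in ps -> q != q' -> [disjoint P q & P q'])].
  move=> u zQ sB; have [F [P [fF _ h1 h2]]] := H u zQ sB.
  exists P; split=> // q /h1[-> -> -> s]; split=> // v /s.
  by apply: (subsetP (targets_sub (forest_valid fF))).
elim: ps => [|[x y] ps IH] u zQ sB.
  exists set0, (fun=> [::]); split=> //; last by rewrite cards0.
  by apply: forestR (forest0 ex0); apply: sub0set.
have pu : perm_eq (unzip1 ((x, y) :: ps) ++ unzip2 ((x, y) :: ps))
    [:: x, y & unzip1 ps ++ unzip2 ps].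
  by rewrite /= perm_cons -cat1s perm_catCA.
move: u; rewrite (perm_uniq pu) /= inE negb_or => /andP[/andP[xy xps] /andP[yps u]].
have zQ' z : z \in unzip1 ps ++ unzip2 ps -> z \in Q :\: W.
  by move=> h; apply: zQ; rewrite (perm_mem pu) !inE h !orbT.
have [|F [P [fF cF h1 h2]]] := IH u zQ'.
  by apply: leq_trans sB; rewrite leq_add2r leq_mul2r leqnSn orbT.
have := zQ x; rewrite (perm_mem pu) mem_head => /(_ isT); rewrite inE => /andP[xW xQ].
have := zQ y; rewrite (perm_mem pu) !inE eqxx orbT => /(_ isT) /andP[yW yQ].
have RW : [disjoint [set z in unzip1 ps ++ unzip2 ps] & W].
  rewrite disjoint_subset; apply/subsetP => z; rewrite !inE => h.
  by have := zQ' z h; rewrite inE => /andP[].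
have [||||F' [p [fF' FF' cF' sp [pp up pF]]]] :=
  connect_roots (i1 := i1) (i2 := i2) (j := j) (x := x) (y := y) Gs
    M0 ex RW WQ joint fF xQ yQ xW yW.
- by rewrite inE.
- by rewrite inE.
- by [].
- by move: cF sB; rewrite /=; set f := #|F|; clear; nia.
exists F', (fun q => if q == (x, y) then p else P q).
have psxy q : q \in ps -> q == (x, y) = false.
  move=> qps; apply: contraNF xps => /eqP qxy.
  by move: qps; rewrite qxy mem_cat => /(map_f fst) ->.
have disj q : q \in ps -> [disjoint P q & p].
  move=> qps; rewrite disjoint_subset; apply/subsetP => v vq; rewrite inE.
  apply/negP => /pF; rewrite inE => /andP[/negP nv _]; apply: nv.
  by have [_ _ _ s] := h1 q qps; apply: s.
split.
- apply: forestR fF'; apply/subsetP => z zR; rewrite inE (perm_mem pu).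
  by move: zR; rewrite !inE; case/or3P => ->; rewrite ?orbT.
- by apply: leq_trans cF' _; rewrite /= mulSn addnC leq_add2l.
- move=> q; rewrite inE; have [-> _|_ /= qps] := eqP.
    by split=> // v /pF; rewrite inE => /andP[].
  have [-> -> -> s] := h1 q qps; split=> // v /s.
  exact: (subsetP (targetsS FF')).
move=> q q'; rewrite !inE.
case eq : (q == (x, y)); case eq' : (q' == (x, y)) => //=.
- by rewrite (eqP eq) (eqP eq') eqxx.
- by move=> _ /disj; rewrite disjoint_sym.
- by move=> /disj.
exact: h2.
Qed.

From mathcomp Require Import all_order all_algebra.
From mathcomp Require Import ring lra.
Import Order.TTheory GRing.Theory Num.Theory.
Local Open Scope ring_scope.

(** * Consequences of expander mixing *)

Definition nbrs_in (T : finType) (G : rel T) (x : T) (Y : {set T}) : {set T} :=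
  [set y in Y | G x y].

Definition edges (T : finType) (G : rel T) (X Y : {set T}) : nat :=
  \sum_(x in X) #|nbrs_in G x Y|.

(** For nonnegative [lam], the infimum over [t] of the right side is the usual [lam] times the
    square root of [#|X| * #|Y|]. Each application picks a convenient [t], so no square roots
    occur. *)
Definition mixing (R : realFieldType) (T : finType) (G : rel T) (d lam : R) : Prop :=
  forall (X Y : {set T}) (t : R), 0 < t ->
  `|(edges G X Y)%:R - d * #|X|%:R * #|Y|%:R / #|T|%:R|
    <= lam / 2 * (t * #|X|%:R + #|Y|%:R / t).

Lemma edges_ge (R : realFieldType) (T : finType) (G : rel T) (X Y : {set T}) (tau : R) :
  (forall x, x \in X -> tau <= #|nbrs_in G x Y|%:R) -> tau * #|X|%:R <= (edges G X Y)%:R.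
Proof.
move=> h; rewrite /edges natr_sum mulr_natr -sumr_const.
exact: ler_sum.
Qed.

Lemma nbrs_inS (T : finType) (G : rel T) x (Y Y' : {set T}) :
  Y \subset Y' -> (#|nbrs_in G x Y| <= #|nbrs_in G x Y'|)%N.
Proof.
by move=> YY; apply: subset_leq_card; apply/subsetP => y; rewrite !inE => /andP[/(subsetP YY)-> ->].
Qed.

(* A maximal [C] obtained from [S] by adding vertices with many neighbours
   inside; mixing forbids it from reaching size [2 |S|]. *)
Lemma closure_exists (R : realFieldType) (T : finType) (G : rel T) (d lam tau : R) (S : {set T}) :
  mixing G d lam -> 0 < tau -> 2 * d * #|S|%:R / #|T|%:R + 3 / 2 * lam < tau ->
  exists C : {set T}, [/\ S \subset C, (#|C| <= 2 * #|S|)%N &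
    forall v, v \notin C -> #|nbrs_in G v C|%:R < tau].
Proof.
move=> mix tau0 small.
(* Each vertex added to [S] has at least [tau] neighbours in the current set, so it adds [tau] to
   the edge count. *)
pose good (C : {set T}) := [&& S \subset C, (#|C| <= 2 * #|S|)%N &
   tau * #|C :\: S|%:R <= (edges G (C :\: S) C)%:R].
have goodS : good S.
  rewrite /good subxx leq_pmull //= setDv cards0 mulr0 /edges big_set0 //.
case: (@arg_maxnP _ S good (fun C => #|C|) goodS) => C /and3P[SC CS eC] maxC.
exists C; split=> // v vC; rewrite ltNge; apply/negP => tv.
have cCS : #|C| = (#|S| + #|C :\: S|)%N by rewrite -(cardsID S C) (setIidPr SC).
have [lt|ge] := ltnP #|C| (2 * #|S|).
  have vS : v \notin S by apply: contra vC; apply: (subsetP SC).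
  have vD : (v |: C) :\: S = v |: (C :\: S).
    by apply/setP => x; rewrite !inE; case: eqP => // ->; rewrite vS.
  have vCS : v \notin C :\: S by rewrite inE (negbTE vC) andbF.
  have : good (v |: C).
    apply/and3P; split.
    - by apply: subset_trans SC (subsetUr _ _).
    - by rewrite cardsU1 vC.
    rewrite vD cardsU1 vCS natrD mulrDr mulr1 /edges big_setU1 //= natrD lerD //.
      by apply: le_trans tv _; rewrite ler_nat nbrs_inS ?subsetUr.
    apply: le_trans eC _; rewrite ler_nat; apply: leq_sum => x _.
    by rewrite nbrs_inS ?subsetUr.
  by move/maxC; rewrite /= cardsU1 vC; clear; lia.
have cD : #|C :\: S| = #|S| by move: cCS CS ge; clear; lia.
have cC : #|C| = (2 * #|S|)%N by move: cCS cD; clear; lia.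
have [S0|S0] := posnP #|S|.
  have : #|nbrs_in G v C|%:R <= #|C|%:R :> R.
    by rewrite ler_nat; apply: subset_leq_card; apply/subsetP => y; rewrite inE => /andP[].
  by rewrite cC S0 muln0 => h; have := le_trans tv h; rewrite leNgt tau0.
(* Here [C :\: S] and [C] have sizes [#|S|] and [2 * #|S|]; with [t = 1] the error is
   [3 / 2 * lam * #|S|]. *)
have := mix (C :\: S) C 1 ltr01; rewrite ler_norml => /andP[_].
rewrite cD cC natrM in eC *; rewrite divr1 mul1r => up.
have S0' : 0 < #|S|%:R :> R by rewrite ltr0n.
have : tau * #|S|%:R < tau * #|S|%:R.
  apply: (le_lt_trans eC).
  have : (2 * d * #|S|%:R / #|T|%:R + 3 / 2 * lam) * #|S|%:R < tau * #|S|%:R by rewrite ltr_pM2r.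
  apply: le_lt_trans; move: up; rewrite lerBlDr => /le_trans; apply.
  rewrite le_eqVlt; apply/orP; left; apply/eqP; ring.
by rewrite ltxx.
Qed.

(** * Disjoint stars and their good leaves *)

Lemma card_bigcup_ord (T : finType) (t k : nat) (A : 'I_t -> {set T}) :
  (forall i, (#|A i| <= k)%N) -> (#|\bigcup_(i < t) A i| <= t * k)%N.
Proof.
elim: t A => [|t IH] A h; first by rewrite big_ord0 cards0.
rewrite big_ord_recr mulSnr /=; apply: leq_trans (leq_card_setU _ _) _.
by rewrite leq_add // IH.
Qed.

(** The closure at most doubles the union of the earlier stars, so a vertex outside it exists. Taken
    as the next centre, it loses fewer than [tau] of its neighbours to those stars. *)
Lemma stars_exist (R : realFieldType) (T : finType) (G : rel T) (dN : nat)
    (lam tau : R) (t : nat) :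
  irreflexive G -> (forall v, #|[set u | G v u]| = dN) -> mixing G dN%:R lam -> 0 < tau ->
  2 * dN%:R * (t * dN.+1)%:R / #|T|%:R + 3 / 2 * lam < tau ->
  (2 * (t * dN.+1) < #|T|)%N ->
  exists (c : nat -> T) (L : nat -> {set T}),
   [/\ forall i, (i < t)%N -> L i \subset [set u | G (c i) u],
       forall i, (i < t)%N -> dN%:R - tau < #|L i|%:R,
       forall i j, (i < t)%N -> (j < t)%N -> i != j -> c i != c j /\ [disjoint L i & L j] &
       forall i j, (i < t)%N -> (j < t)%N -> c i \notin L j].
Proof.
move=> Gi Gd mix tau0; elim: t => [|t IH] small nT.
  have /card_gt0P[x0 _] : (0 < #|T|)%N by apply: leq_ltn_trans nT.
  by exists (fun=> x0), (fun=> set0); split.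
have T0 : 0 < #|T|%:R :> R by rewrite ltr0n; apply: leq_ltn_trans nT.
have small' : 2 * dN%:R * (t * dN.+1)%:R / #|T|%:R + 3 / 2 * lam < tau.
  apply: le_lt_trans small; rewrite lerD2r ler_pM2r ?invr_gt0 //.
  by rewrite ler_wpM2l ?mulr_ge0 // ler_nat mulSn leq_addl.
have nT' : (2 * (t * dN.+1) < #|T|)%N.
  by apply: leq_ltn_trans nT; rewrite leq_mul2l mulSn leq_addl.
have [c [L [LN Lc dis cL]]] := IH small' nT'.
pose S := \bigcup_(i < t) (c i |: L i).
have cS : (#|S| <= t * dN.+1)%N.
  apply: card_bigcup_ord => i; rewrite cardsU1 -add1n leq_add ?leq_b1 //.
  by rewrite -(Gd (c i)) subset_leq_card // LN.
have [|C [SC CS Cv]] := @closure_exists R T G dN%:R lam tau S mix tau0.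
  apply: le_lt_trans small'; rewrite lerD2r ler_pM2r ?invr_gt0 //.
  by rewrite ler_wpM2l ?mulr_ge0 // ler_nat.
have /card_gt0P[v] : (0 < #|~: C|)%N.
  by have := cardsC C; move: CS cS nT'; clear; lia.
rewrite inE => vC.
pose L0 := [set u | G v u] :\: S.
have cL0 : dN%:R - tau < #|L0|%:R.
  have : #|[set u | G v u] :&: S|%:R <= #|nbrs_in G v C|%:R :> R.
    rewrite ler_nat; apply: subset_leq_card; apply/subsetP => u; rewrite !inE.
    by move=> /andP[-> /(subsetP SC) ->].
  have := cardsID S [set u | G v u]; rewrite Gd => <-.
  by rewrite natrD -/L0; have := Cv v vC; lra.
have SP x : x \in S -> exists2 i, (i < t)%N & (x == c i) || (x \in L i).
  by move=> /bigcupP[i _]; rewrite !inE; exists i.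
have inS i x : (i < t)%N -> (x == c i) || (x \in L i) -> x \in S.
  by move=> it xi; apply/bigcupP; exists (Ordinal it) => //; rewrite !inE.
have vS : v \notin S by apply: contra vC; apply: (subsetP SC).
exists (fun i => if i == t then v else c i), (fun i => if i == t then L0 else L i).
have lt_t i : (i < t.+1)%N -> i != t -> (i < t)%N by rewrite ltnS ltn_neqAle => -> ->.
split.
- move=> i it; have [_|ne] := eqVneq i t; last exact/LN/lt_t.
  exact: subsetDl.
- by move=> i it; have [_|ne] := eqVneq i t; last exact/Lc/lt_t.
- move=> i j it jt ij; case: (eqVneq i t) => [ei|nei]; case: (eqVneq j t) => [ej|nej].
  + by rewrite ei ej eqxx in ij.
  + have jt' := lt_t j jt nej; split.
      by apply: contraNneq vS => ->; apply: (inS j) => //; rewrite eqxx.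
    rewrite disjoint_sym disjoint_subset; apply/subsetP => x xL.
    by rewrite !inE (inS j) // xL orbT.
  + have it' := lt_t i it nei; split.
      by rewrite eq_sym; apply: contraNneq vS => ->; apply: (inS i) => //; rewrite eqxx.
    rewrite disjoint_subset; apply/subsetP => x xL.
    by rewrite !inE (inS i) // xL orbT.
  + by apply: dis => //; apply: lt_t.
move=> i j it jt; have [_|nei] := eqVneq i t; have [_|nej] := eqVneq j t.
- by rewrite !inE Gi andbF.
- by apply: contra vS => vL; apply: (inS j); rewrite ?lt_t // vL orbT.
- by rewrite !inE (inS i) ?eqxx ?lt_t.
- by apply: cL; apply: lt_t.
Qed.

Lemma injection_into (T : finType) (A : {set T}) (m : nat) :
  (m <= #|A|)%N -> exists2 f : 'I_m -> T, injective f & forall i, f i \in A.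
Proof.
move=> mA; exists (fun i => enum_val (widen_ord mA i)) => [i j|i]; last exact: enum_valP.
by move=> /enum_val_inj /(congr1 val) /= /val_inj.
Qed.

Lemma sum_card_disjoint (I T : finType) (J : {set I}) (A : I -> {set T}) (B : {set T}) :
  (forall i j, i != j -> [disjoint A i & A j]) -> (\sum_(i in J) #|A i :&: B| <= #|B|)%N.
Proof.
move=> dis.
have -> : (\sum_(i in J) #|A i :&: B| = \sum_(i in J) \sum_(x in B) (x \in A i))%N.
  apply: eq_bigr => i _; rewrite -sum1_card big_mkcond [RHS]big_mkcond.
  by apply: eq_bigr => x _; rewrite inE; case: (x \in A i); case: (x \in B).
rewrite exchange_big -sum1_card; apply: leq_sum => x _.
have -> : (\sum_(i in J) (x \in A i) = #|[set i in J | x \in A i]|)%N.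
  rewrite -sum1_card big_mkcond [RHS]big_mkcond.
  by apply: eq_bigr => i _; rewrite inE; case: (i \in J); case: (x \in A i).
apply/card_le1_eqP => i j; rewrite !inE => /andP[_ xi] /andP[_ xj].
by apply/eqP; apply: contraTT xj => ij; rewrite (disjointFl (dis _ _ ij) xi).
Qed.

(* By mixing at most [eta^2 d^2 / 2048] vertices of the stars are bad, that is
   have many neighbours in [C]; a discarded star contains at least [7/8 eta d] of
   them. *)
Lemma star_system (R : realFieldType) (T : finType) (G : rel T) (dN m : nat) (lam eta : R) :
  irreflexive G -> (forall v, #|[set u | G v u]| = dN) -> mixing G dN%:R lam ->
  0 < eta -> eta < 2^-1 -> 0 <= lam -> lam <= eta ^+ 2 * dN%:R / 2048 -> (0 < dN)%N ->
  128 * dN%:R ^+ 2 <= eta * #|T|%:R -> m%:R <= (1 - eta) * dN%:R ->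
  exists (C : {set T}) (phi : 'I_m -> T) (lf : 'I_m -> 'I_m -> T),
   [/\ (#|C| <= 2 * (dN * dN.+1))%N,
       forall v, v \notin C -> #|nbrs_in G v C|%:R < eta * dN%:R / 8,
       injective phi /\ (forall i, phi i \in C),
       forall i j, [/\ lf i j \in C, G (phi i) (lf i j) &
         #|nbrs_in G (lf i j) C|%:R < eta * dN%:R / 8] &
       (forall i j i' j', lf i j = lf i' j' -> i = i' /\ j = j') /\
       (forall i j k, lf i j != phi k)].
Proof.
move=> Gi Gd mix e0 e1 l0 l1 d0 dT md.
set tau := eta * dN%:R / 8.
have dR : 1 <= dN%:R :> R by rewrite ler1n.
have tau0 : 0 < tau by rewrite /tau; move: e0 dR; clear; nra.
have T0 : 0 < #|T|%:R :> R by move: e0 dR dT; clear; nra.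
have dd : (dN * dN.+1)%:R <= 2 * dN%:R ^+ 2 :> R.
  by rewrite natrM -natr1; move: dR; clear; nra.
have eta2d : eta ^+ 2 * dN%:R <= eta * dN%:R.
  by rewrite ler_wpM2r ?ler0n //; move: e0 e1; clear; nra.
have lt_tau : lam <= tau / 128.
  by have := mulr_gt0 e0 (lt_le_trans ltr01 dR); move: l1 eta2d; rewrite /tau; clear; lra.
(* The assumption [128 * d ^ 2 <= eta * #|T|] is tuned for this:
   [d * 4 * d ^ 2 / #|T| <= eta * d / 32], which is [tau / 4]. *)
have dens (k : R) : k <= 4 * dN%:R ^+ 2 -> dN%:R * k / #|T|%:R <= tau / 4.
  move=> kd; rewrite ler_pdivrMr //.
  have : dN%:R * k <= dN%:R * (4 * dN%:R ^+ 2) by rewrite ler_pM2l // (lt_le_trans ltr01).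
  have : dN%:R * (128 * dN%:R ^+ 2) <= dN%:R * (eta * #|T|%:R).
    by rewrite ler_pM2l // (lt_le_trans ltr01).
  by rewrite /tau; lra.
have small (k : nat) : (k <= dN * dN.+1)%N ->
    2 * dN%:R * k%:R / #|T|%:R + 3 / 2 * lam < tau.
  move=> kd; have : dN%:R * (2 * k%:R) / #|T|%:R <= tau / 4.
    apply: dens; have : k%:R <= (dN * dN.+1)%:R :> R by rewrite ler_nat.
    by lra.
  have -> : dN%:R * (2 * k%:R) / #|T|%:R = 2 * dN%:R * k%:R / #|T|%:R :> R by ring.
  by lra.
have [||c [L [LN Lc dis cL]]] := @stars_exist R T G dN lam tau dN Gi Gd mix tau0.
- exact: small.
- by rewrite -(ltr_nat R) natrM; nra.
pose S := \bigcup_(i < dN) (c i |: L i).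
have cS : (#|S| <= dN * dN.+1)%N.
  apply: card_bigcup_ord => i; rewrite cardsU1 -add1n leq_add ?leq_b1 //.
  by have := subset_leq_card (LN i (ltn_ord i)); rewrite Gd.
have [|C [SC CS Cv]] := @closure_exists R T G dN%:R lam tau S mix tau0.
  exact: small.
pose bad := [set x in S | tau <= #|nbrs_in G x C|%:R].
have CR : #|C|%:R <= 4 * dN%:R ^+ 2 :> R.
  have : #|C|%:R <= (2 * (dN * dN.+1))%:R :> R.
    by rewrite ler_nat (leq_trans CS) // leq_mul2l.
  by rewrite natrM; lra.
have badR : #|bad|%:R <= eta ^+ 2 * dN%:R ^+ 2 / 2048 :> R.
  have : tau * #|bad|%:R <= (edges G bad C)%:R.
    by apply: edges_ge => x; rewrite inE => /andP[].
  (* With the weight [t = 128 / eta] the term in [#|bad|] is [64 * lam / eta * #|bad|], at most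
     [tau / 4 * #|bad|]. With the main term it takes up half of the left side. *)
  have t0 : 0 < 128 / eta by rewrite divr_gt0.
  have := mix bad C _ t0; rewrite ler_norml => /andP[_]; rewrite lerBlDr => up lo.
  have {lo up} := le_trans lo up.
  set b := #|bad|%:R; have b0 : 0 <= b by rewrite ler0n.
  have -> : #|C|%:R / (128 / eta) = #|C|%:R * (eta / 128) :> R by rewrite invf_div.
  have -> : dN%:R * b * #|C|%:R / #|T|%:R = dN%:R * #|C|%:R / #|T|%:R * b :> R by ring.
  have h1 : dN%:R * #|C|%:R / #|T|%:R * b <= tau / 4 * b by rewrite ler_wpM2r // dens.
  have h2 : lam / 2 * (128 / eta * b) <= tau / 4 * b.
    rewrite mulrA ler_wpM2r // mulrA ler_pdivrMr //.
    by rewrite /tau; move: l1 e0; clear; nra.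
  have h3 : lam / 2 * (#|C|%:R * (eta / 128)) <=
      eta ^+ 2 * dN%:R / 2048 / 2 * (4 * dN%:R ^+ 2 * (eta / 128)).
    apply: ler_pM; [by move: l0; clear; lra| |by move: l1; clear; lra|].
      by apply: mulr_ge0; [exact: ler0n|move: e0; clear; lra].
    by apply: ler_wpM2r CR; move: e0; clear; lra.
  rewrite mulrDr => h.
  have {h1 h2 h3 h} : tau / 2 * b <=
      eta ^+ 2 * dN%:R / 2048 / 2 * (4 * dN%:R ^+ 2 * (eta / 128)) by move: h1 h2 h3 h; clear; lra.
  have -> : eta ^+ 2 * dN%:R / 2048 / 2 * (4 * dN%:R ^+ 2 * (eta / 128)) =
    tau / 2 * (eta ^+ 2 * dN%:R ^+ 2 / 2048 * (1 / 4)) by rewrite /tau; field.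
  have t2 : 0 < tau / 2 by lra.
  rewrite (ler_pM2l t2) => /le_trans; apply.
  apply: ler_piMr; last by clear; lra.
  by rewrite divr_ge0 ?ler0n // mulr_ge0 ?sqr_ge0.
pose good := [set i : 'I_dN | (m <= #|L i :\: bad|)%N].
have mgood : (m <= #|good|)%N.
  (* A discarded star has more than [d - tau] leaves but fewer than [m <= (1 - eta) * d] outside
     [bad]; the difference is at least [eta * d - tau], that is [7 / 8 * eta * d]. *)
  have badstars : #|~: good|%:R * (7 / 8 * eta * dN%:R) <= #|bad|%:R.
    apply: le_trans (_ : (\sum_(i in ~: good) #|L i :&: bad|)%:R <= _).
      set K := 7 / 8 * eta * dN%:R.
      rewrite natr_sum mulrC mulr_natr -sumr_const; apply: ler_sum => i.
      rewrite /K !inE -ltnNge => im; have := Lc i (ltn_ord i).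
      rewrite -(cardsID bad (L i)) natrD.
      have : #|L i :\: bad|%:R <= m%:R :> R by rewrite ler_nat ltnW.
      by rewrite /tau; lra.
    rewrite ler_nat.
    apply: (@sum_card_disjoint _ _ (~: good) (fun i : 'I_dN => L i) bad) => i j ij.
    by have [] := dis i j (ltn_ord i) (ltn_ord j) ij.
  have cg := cardsC good; rewrite card_ord in cg.
  have : #|~: good|%:R <= eta * dN%:R.
    have : 0 < 7 / 8 * eta * dN%:R by move: e0 dR; clear; nra.
    move=> h; rewrite -(ler_pM2r h); apply: le_trans badstars _.
    apply: le_trans badR _; nra.
  have : dN%:R = #|good|%:R + #|~: good|%:R :> R by rewrite -natrD cg.
  by move=> h1 h2; rewrite -(ler_nat R); move: h1 h2 md; clear; lra.
have [f finj fgood] := injection_into mgood.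
have /fin_all_exists[lf lfP] : forall i : 'I_m, exists g : 'I_m -> T,
    injective g /\ forall j, g j \in L (f i) :\: bad.
  by move=> i; have := fgood i; rewrite inE => /injection_into[g gi gP]; exists g.
have fij i i' : f i = f i' :> nat -> i = i' by move=> /val_inj /finj.
have inS i x : (x == c (f i)) || (x \in L (f i)) -> x \in S.
  by move=> xi; apply/bigcupP; exists (f i) => //; rewrite !inE.
exists C, (fun i => c (f i)), lf; split=> //.
- by rewrite (leq_trans CS) // leq_mul2l.
- split=> [i i' /eqP|i]; last by apply: (subsetP SC); apply: (inS i); rewrite eqxx.
  apply: contraTeq => ii'; have [] // := dis (f i) (f i') (ltn_ord _) (ltn_ord _).
  by apply: contra ii' => /eqP /fij ->.
- move=> i j; have [_ /(_ j)] := lfP i; rewrite in_setD => /andP[nb lL].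
  have lS : lf i j \in S by apply: (inS i); rewrite lL orbT.
  split; first exact: (subsetP SC).
    by have := subsetP (LN (f i) (ltn_ord _)) _ lL; rewrite inE.
  by move: nb; rewrite inE lS /= -ltNge.
split=> [i j i' j' E|i j k].
  have [gi /(_ j)] := lfP i; rewrite in_setD => /andP[_ lL].
  have [gi' /(_ j')] := lfP i'; rewrite in_setD -E => /andP[_ lL'].
  have ii' : i = i'.
    apply/eqP; apply: contraT => ii'.
    have [|_ D] := dis (f i) (f i') (ltn_ord _) (ltn_ord _).
      by apply: contra ii' => /eqP /fij ->.
    by rewrite (disjointFr D lL) in lL'.
  by subst i'; split=> //; apply: gi.
have [_ /(_ j)] := lfP i; rewrite in_setD => /andP[_ lL].
by apply: contraTneq lL => ->; apply: cL.
Qed.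

(** * Expansion outside the closure, and construction of the subdivision *)

Lemma expansion_of_mixing (R : realFieldType) (T : finType) (G : rel T) (dN : nat)
    (lam : R) (C X : {set T}) :
  (forall v, #|[set u | G v u]| = dN) -> mixing G dN%:R lam -> (0 < dN)%N ->
  0 <= lam -> lam < dN%:R / 32 ->
  (forall x, x \in X -> #|nbrs_in G x C|%:R <= dN%:R / 2 :> R) ->
  (256 * #|X| <= #|T|)%N -> (64 * #|X| <= #|nbhd G (~: C) X|)%N.
Proof.
move=> Gd mix d0 l0 l1 XC XT.
set Y := nbhd G (~: C) X; rewrite leqNgt; apply/negP => YX.
have X0 : (0 < #|X|)%N by move: YX; case: #|X|.
have d0' : 0 < dN%:R :> R by rewrite ltr0n.
have X0' : 0 < #|X|%:R :> R by rewrite ltr0n.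
have T0 : 0 < #|T|%:R :> R by rewrite ltr0n; apply: leq_trans XT; rewrite muln_gt0.
(* All neighbours of [x] outside [C] lie in [Y], and at most half of them are in [C]. *)
have lo : dN%:R / 2 * #|X|%:R <= (edges G X Y)%:R :> R.
  apply: edges_ge => x xX.
  have -> : nbrs_in G x Y = [set u | G x u] :\: C.
    apply/setP => u; rewrite !inE; apply/idP/idP.
      by move=> /andP[/andP[-> _] ->].
    by move=> /andP[-> xu]; rewrite xu andbT; apply/exists_inP; exists x.
  have := XC x xX; have := cardsID C [set u | G x u]; rewrite Gd => <-.
  have -> : nbrs_in G x C = [set u | G x u] :&: C.
    by apply/setP => u; rewrite !inE andbC.
  by rewrite natrD; clear; lra.
(* The weight 8 balances [#|X|] against [64 * #|X|]. Main term and error are then each at most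
   [d / 4 * #|X|], the error strictly, against the lower bound [d / 2 * #|X|]. *)
have := mix X Y 8 ltac:(lra); rewrite ler_norml => /andP[_]; rewrite lerBlDr => up.
have YR : #|Y|%:R <= 64 * #|X|%:R :> R by rewrite -natrM ler_nat ltnW.
have XR : 256 * #|X|%:R <= #|T|%:R :> R by rewrite -natrM ler_nat.
have h1 : dN%:R * #|X|%:R * #|Y|%:R / #|T|%:R <= dN%:R / 4 * #|X|%:R :> R.
  rewrite ler_pdivrMr //.
  apply: le_trans (_ : dN%:R * #|X|%:R * (64 * #|X|%:R) <= _ :> R).
    by rewrite ler_wpM2l // mulr_ge0 // ltW.
  have : dN%:R * #|X|%:R * (256 * #|X|%:R) <= dN%:R * #|X|%:R * #|T|%:R :> R.
    by rewrite ler_wpM2l // mulr_ge0 // ltW.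
  lra.
have h2 : lam / 2 * (8 * #|X|%:R + #|Y|%:R / 8) <= lam * (8 * #|X|%:R).
  by rewrite -mulrA ler_wpM2l //; lra.
have h3 : lam * (8 * #|X|%:R) < dN%:R / 32 * (8 * #|X|%:R) by rewrite ltr_pM2r //; lra.
have := le_trans lo up; lra.
Qed.

Lemma joint_of_mixing (R : realFieldType) (T : finType) (G : rel T) (d lam : R)
    (N : nat) (A B : {set T}) :
  mixing G d lam -> 0 <= lam -> (0 < N)%N -> lam * #|T|%:R < d * N%:R ->
  (N <= #|A|)%N -> (N <= #|B|)%N -> exists a b, [/\ a \in A, b \in B & G a b].
Proof.
move=> mix l0 N0 lN NA NB.
have [/exists_inP[a aA /exists_inP[b bB Gab]]|/exists_inPn no] :=
  boolP [exists a in A, exists b in B, G a b]; first by exists a, b.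
exfalso; have e0 : edges G A B = 0%N.
  apply: big1 => a /no/exists_inPn nb; apply/eqP; rewrite cards_eq0; apply/eqP/setP => b.
  by rewrite !inE; apply/negP => /andP[/nb/negP].
have A0 : 0 < #|A|%:R :> R by rewrite ltr0n; apply: leq_trans NA.
have B0 : 0 < #|B|%:R :> R by rewrite ltr0n; apply: leq_trans NB.
have N0' : 0 < N%:R :> R by rewrite ltr0n.
have T0 : 0 < #|T|%:R :> R.
  by rewrite ltr0n; exact: leq_trans N0 (leq_trans NA (max_card _)).
have d0 : 0 < d by rewrite -(pmulr_lgt0 _ N0'); apply: le_lt_trans lN; apply: mulr_ge0 l0 (ltW T0).
have NA' : N%:R <= #|A|%:R :> R by rewrite ler_nat.
have NB' : N%:R <= #|B|%:R :> R by rewrite ler_nat.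
have := mix A B 1 ltr01; rewrite e0 sub0r normrN ger0_norm; last first.
  by rewrite divr_ge0 ?mulr_ge0 // ltW.
rewrite ler_pdivrMr // mul1r divr1.
set a : R := #|A|%:R in A0 NA' *; set b : R := #|B|%:R in B0 NB' *.
set t : R := #|T|%:R in T0 lN * => h.
have h1 : lam * t * (a + b) < d * N%:R * (a + b) by rewrite ltr_pM2r // addr_gt0.
(* As [N] is below both sizes, [t = 1] suffices even for sets of very different sizes. *)
have h2 : N%:R * (a + b) <= 2 * (a * b) by nra.
have h3 : d * (N%:R * (a + b)) <= d * (2 * (a * b)) by rewrite ler_pM2l.
lra.
Qed.

(* The trees grown from the two leaves have depths [k + 1] and [k + 2], giving
   [2 k + 3] vertices strictly between the leaves. *)
Lemma subdivision_of_mixing (R : realFieldType) (T : finType) (G : rel T)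
    (dN m k j : nat) (lam eta : R) :
  symmetric G -> irreflexive G -> (forall v, #|[set u | G v u]| = dN) ->
  mixing G dN%:R lam ->
  0 < eta -> eta < 2^-1 -> 0 <= lam -> lam < eta ^+ 2 * dN%:R / 2048 -> (0 < dN)%N ->
  128 * dN%:R ^+ 2 <= eta * #|T|%:R -> m%:R <= (1 - eta) * dN%:R ->
  (j <= k.+1)%N -> eta ^+ 2 / 2048 * #|T|%:R <= (4 ^ j)%:R ->
  (512 <= #|T|)%N ->
  (dN * dN * (2 * k + 3) + (2 * k + 3 + 4 * 4 ^ j) <= 60 * (#|T| %/ 512))%N ->
  exists (phi : 'I_m -> T) (P : 'I_m -> 'I_m -> seq T),
    injective phi /\
    (forall i j : 'I_m, (i < j)%N ->
       [/\ size (P i j) = (2 * k + 5)%N,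
           path G (phi i) (rcons (P i j) (phi j)),
           uniq (P i j) &
           forall x, x \in P i j -> x \notin codom phi]) /\
    (forall i j i' j' : 'I_m, (i < j)%N -> (i' < j')%N -> (i, j) != (i', j') ->
       [disjoint P i j & P i' j']).
Proof.
move=> Gs Gi Gd mix e0 e1 l0 l1 d0 dT md jk jT nT bud.
have [C [phi [lf [_ CC [phi_inj phiC] lfP [lf_inj lf_phi]]]]] :=
  star_system Gi Gd mix e0 e1 l0 (ltW l1) d0 dT md.
have dR : 1 <= dN%:R :> R by rewrite ler1n.
have T0 : 0 < #|T|%:R :> R by rewrite ltr0n; apply: leq_trans nT.
have tau_le : eta * dN%:R / 8 <= dN%:R / 2 by move: e0 e1 dR; clear; nra.
have eta2d : eta ^+ 2 * dN%:R <= dN%:R.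
  by rewrite ler_piMl // expr_le1 // ?ltW //; move: e1; clear; lra.
(* [Q] contains the complement of [C] and also the good leaves, which lie in [C] and serve as
   roots. *)
pose Q := [set x | #|nbrs_in G x C|%:R < eta * dN%:R / 8].
pose M := (#|T| %/ 512)%N.
have M0 : (0 < M)%N by rewrite divn_gt0.
have MT : (512 * M <= #|T|)%N by rewrite mulnC leq_trunc_div.
have exp64 (X : {set T}) : X \subset Q -> (#|X| <= 2 * M)%N ->
    (64 * #|X| <= #|nbhd G (~: C) X|)%N.
  move=> XQ XM; apply: (expansion_of_mixing (lam := lam) Gd mix d0 l0).
  - by move: l1 eta2d dR; clear; lra.
  - move=> x /(subsetP XQ); rewrite inE => /ltW xC; exact: le_trans tau_le.
  - by apply: leq_trans MT; move: XM; set x := #|X|; clear; lia.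
have WQ : ~: C \subset Q by apply/subsetP => v; rewrite !inE => /CC.
(* Of the factor 64, four parts are the promised children; the other sixty give the budget, since
   [#|X|] is at least [M]. *)
have ex : expands G (~: C) Q 4 M (60 * M).
  move=> X XQ /andP[MX XM]; apply: leq_trans (exp64 X XQ XM).
  by move: MX; set x := #|X|; clear; lia.
have ex0 (X : {set T}) : X \subset Q -> (#|X| <= 2 * M)%N -> (4 * #|X| <= #|nbhd G (~: C) X|)%N.
  by move=> XQ XM; apply: leq_trans (exp64 X XQ XM); rewrite leq_mul2r orbT.
have joint (A A' : {set T}) : (4 ^ j <= #|A|)%N -> (4 ^ j <= #|A'|)%N ->
    exists a b, [/\ a \in A, b \in A' & G a b].
  apply: (joint_of_mixing mix l0); first by rewrite expn_gt0.
  apply: lt_le_trans (_ : eta ^+ 2 * dN%:R / 2048 * #|T|%:R <= _).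
    by rewrite ltr_pM2r.
  have : dN%:R * (eta ^+ 2 / 2048 * #|T|%:R) <= dN%:R * (4 ^ j)%:R.
    by rewrite ler_wpM2l // ler0n.
  by clear; lra.
pose dom := enum [set q : 'I_m * 'I_m | (q.1 < q.2)%N].
have domP q : (q \in dom) = (q.1 < q.2)%N by rewrite mem_enum inE.
(* The leaf [lf i j] of star [i] is reserved for the connection to star [j], so all ends are
   distinct. *)
pose ends (q : 'I_m * 'I_m) := (lf q.1 q.2, lf q.2 q.1).
pose ps := map ends dom.
have mdN : (m <= dN)%N.
  by rewrite -(ler_nat R); apply: le_trans md _; rewrite ler_piMl //; move: e0; clear; lra.
have sps : (size ps <= dN * dN)%N.
  rewrite size_map -cardE; apply: leq_trans (max_card _) _.
  by rewrite card_prod card_ord leq_mul.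
have lf2_inj : injective (fun q : 'I_m * 'I_m => lf q.1 q.2).
  by move=> [i1 i2] [j1 j2] /= /lf_inj[-> ->].
have psE : unzip1 ps ++ unzip2 ps =
    [seq lf q.1 q.2 | q : 'I_m * 'I_m <- dom ++ [seq (q.2, q.1) | q <- dom]].
  by rewrite map_cat /unzip1 /unzip2 -!map_comp.
(* The initial paths have lengths [k.+1 - j] and [k.+2 - j], which bring the total depths to [k + 1]
   and [k + 2]; [jk] makes the truncated subtractions exact. *)
have sizeE : (k.+1 - j + (k.+2 - j) + 2 * j = 2 * k + 3)%N by move: jk; clear; lia.
have [|||P [P1 P2]] := @linkage T G (~: C) Q M (60 * M) (k.+1 - j) (k.+2 - j) j ps
  Gs M0 ex WQ ex0 joint.
- rewrite psE (map_inj_uniq lf2_inj) cat_uniq enum_uniq /=; apply/andP; split.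
    apply/hasPn => q /mapP[q' q'd ->]; move: q'd; rewrite !domP /=.
    by move=> lt; rewrite -leqNgt ltnW.
  by rewrite map_inj_uniq ?enum_uniq // => -[a b] [a' b'] /= [-> ->].
- move=> z; rewrite psE => /mapP[q _ ->]; have [lC _ lN] := lfP q.1 q.2.
  by rewrite !inE lC lN.
- rewrite sizeE; apply: leq_trans bud; rewrite -/M leq_add //.
    by rewrite leq_mul2r sps orbT.
  by rewrite leq_add2r -sizeE leq_addr.
have endsP (a b : 'I_m) : (a < b)%N -> (lf a b, lf b a) \in ps.
  by move=> ab; apply/mapP; exists (a, b); rewrite ?domP.
(* The two leaves are themselves interior vertices, raising [2 k + 3] to [2 k + 5]. *)
exists phi, (fun a b => rcons (lf a b :: P (lf a b, lf b a)) (lf b a)).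
split=> //.
have inP (a b : 'I_m) x : (a < b)%N -> x \in P (lf a b, lf b a) -> x \notin C.
  by move=> /endsP/P1[_ _ _ sub] /sub; rewrite inE.
have lfC a b : lf a b \in C by have [] := lfP a b.
split=> [a b ab|a b a' b' ab ab' ne].
  have [sP pP uP subP] := P1 _ (endsP a b ab).
  have [_ Ga _] := lfP a b; have [_ Gb _] := lfP b a.
  split.
  - by rewrite size_rcons /= sP sizeE; clear; lia.
  - by rewrite rcons_path last_rcons /= Ga pP /= Gs.
  - rewrite rcons_uniq /= uP andbT inE negb_or; apply/andP; split; last first.
      by apply/negP => /(inP a b _ ab); rewrite lfC.
    apply/andP; split.
      by apply/eqP => /lf_inj[ba _]; rewrite ba ltnn in ab.
    by apply/negP => /(inP a b _ ab); rewrite lfC.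
  move=> x; rewrite mem_rcons !inE => /or3P[/eqP->|/eqP->|/(inP a b _ ab) xC].
  - by apply/negP => /codomP[c /eqP]; rewrite (negbTE (lf_phi _ _ _)).
  - by apply/negP => /codomP[c /eqP]; rewrite (negbTE (lf_phi _ _ _)).
  by apply: contra xC => /codomP[c ->].
have lf_ne : [/\ lf a b != lf a' b', lf b a != lf b' a', lf a b != lf b' a' & lf b a != lf a' b'].
  split; apply/eqP => /lf_inj[E1 E2]; subst.
  - by rewrite eqxx in ne.
  - by rewrite eqxx in ne.
  - by have := ltn_trans ab ab'; rewrite ltnn.
  - by have := ltn_trans ab ab'; rewrite ltnn.
have [n1 n2 n3 n4] := lf_ne.
have dP : [disjoint P (lf a b, lf b a) & P (lf a' b', lf b' a')].
  by apply: P2; rewrite ?endsP // xpair_eqE negb_and n1.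
rewrite disjoint_subset; apply/subsetP => x; rewrite mem_rcons !inE mem_rcons !inE !negb_or.
case/or3P => [/eqP->|/eqP->|xP].
- rewrite n2 n4 /=; apply/negP => /(inP _ _ _ ab'); by rewrite lfC.
- rewrite n1 n3 /=; apply/negP => /(inP _ _ _ ab'); by rewrite lfC.
rewrite (disjointFr dP xP) andbT.
have xC := inP _ _ _ ab xP.
by apply/andP; split; apply: contraNneq xC => ->.
Qed.

Require Import Defs.
From HB Require Import structures.
From mathcomp Require Import all_classical all_reals all_analysis.
From mathcomp Require Import complex spectral.
Import Order.TTheory GRing.Theory Num.Theory.
Local Open Scope ring_scope.
Local Open Scope sesquilinear_scope.

(** * The expander mixing lemma *)

Lemma char_poly_conj (F : fieldType) (n : nat) (P M : 'M[F]_n) :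
  P \in unitmx -> char_poly (invmx P *m M *m P) = char_poly M.
Proof.
move=> uP; rewrite /char_poly /char_poly_mx.
have uPX : map_mx (@polyC F) P \in unitmx.
  by rewrite unitmxE det_map_mx rmorph_unit // -unitmxE.
have -> : 'X%:M - map_mx (@polyC F) (invmx P *m M *m P) =
  invmx (map_mx (@polyC F) P) *m ('X%:M - map_mx (@polyC F) M) *m map_mx (@polyC F) P.
  rewrite mulmxBr mulmxBl !map_mxM map_invmx; congr (_ - _).
  by rewrite scalar_mxC -mulmxA mulVmx // mulmx1.
rewrite !det_mulmx mulrAC -det_mulmx mulVmx // det1 mul1r //.
Qed.

(** The index [i] uses up the single factor at [mu]; after cancelling it, every other [D j] is a
    root of the product over [s]. *)
Lemma prod_XsubC_at_most_one (F : fieldType) (I : finType) (D : I -> F) (mu : F)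
    (s : seq F) (i j : I) :
  \prod_k ('X - (D k)%:P) = ('X - mu%:P) * \prod_(x <- s) ('X - x%:P) ->
  D i \notin s -> j != i -> D j \in s.
Proof.
move=> E Di ji.
have Dmu : D i = mu.
  have /eqP := congr1 (fun p => p.[D i]) E.
  rewrite horner_prod (bigD1 i) //= hornerXsubC subrr mul0r eq_sym.
  rewrite hornerM mulf_eq0 hornerXsubC subr_eq0 => /orP[/eqP//|].
  by rewrite -rootE root_prod_XsubC (negbTE Di).
move: E; rewrite (bigD1 i) //= Dmu => /mulfI; rewrite polyXsubC_eq0 => /(_ isT) E.
have /eqP := congr1 (fun p => p.[D j]) E.
rewrite horner_prod (bigD1 j) //= hornerXsubC subrr mul0r eq_sym.
by rewrite -rootE root_prod_XsubC.
Qed.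

(* In an orthonormal eigenbasis the all-ones vector is supported on the single
   coordinate of eigenvalue [d], which contributes the main term. The weight [t]
   stands for Cauchy-Schwarz: optimising over it gives [lam |u| |v|]. *)
Lemma hermitian_mixing (C : numClosedFieldType) (n : nat) (A : 'M[C]_n) (d lam mu : C)
    (s : seq C) (u v : 'rV[C]_n) (t : C) :
  (0 < n)%N -> A \is hermsymmx ->
  const_mx 1 *m A = d *: (const_mx 1 : 'rV[C]_n) ->
  char_poly A = ('X - mu%:P) * \prod_(x <- s) ('X - x%:P) ->
  (forall x, x \in s -> `|x| <= lam) -> 0 <= lam -> lam < d -> 0 < t ->
  `|(u *m A *m v ^t*) 0 0 -
     d * (u *m (const_mx 1 : 'rV[C]_n)^t*) 0 0 * ((v *m (const_mx 1 : 'rV[C]_n)^t*) 0 0)^* / n%:R|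
    <= lam / 2 * (t * (u *m u^t*) 0 0 + (v *m v^t*) 0 0 / t).
Proof.
move=> n0 Ah A1 cA sl l0 ld t0.
have [[P D] /= uP AE] : exists2 sp : 'M[C]_n * 'rV[C]_n, sp.1 \is unitarymx &
    A = invmx sp.1 *m diag_mx sp.2 *m sp.1.
  by apply/orthomx_spectral_subproof; apply: hermitian_normalmx.
have Pu : P \in unitmx := unitarymx_unit uP.
have PV : invmx P = P^t* by rewrite invmx_unitary.
pose cf (w : 'rV[C]_n) := w *m P^t*.
have dotE (w1 w2 : 'rV[C]_n) : (w1 *m w2^t*) 0 0 = \sum_k cf w1 0 k * (cf w2 0 k)^*.
  have -> : w1 *m w2^t* = cf w1 *m (cf w2)^t*.
    rewrite /cf trmx_mul map_mxM /= trmxCK mulmxA.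
    by rewrite -[w1 *m _ *m P]mulmxA -PV mulVmx // mulmx1.
  by rewrite mxE; apply: eq_bigr => k _; rewrite !mxE.
have formE (w1 w2 : 'rV[C]_n) :
    (w1 *m A *m w2^t*) 0 0 = \sum_k D 0 k * (cf w1 0 k * (cf w2 0 k)^*).
  have -> : w1 *m A *m w2^t* = cf w1 *m diag_mx D *m (cf w2)^t*.
    rewrite /cf trmx_mul map_mxM /= trmxCK AE PV !mulmxA.
    by [].
  rewrite mxE; apply: eq_bigr => k _; rewrite mul_mx_diag !mxE.
  by rewrite mulrA; congr (_ * _); rewrite mulrC.
pose one : 'rV[C]_n := const_mx 1; pose c := cf one.
have cD k : c 0 k * D 0 k = d * c 0 k.
  have : c *m diag_mx D = d *: c.
    have : one *m A *m P^t* = d *: c by rewrite A1 -scalemxAl.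
    by rewrite AE PV !mulmxA -[_ *m P *m _]mulmxA -PV mulmxV // mulmx1 PV.
  move=> E; have -> : c 0 k * D 0 k = (c *m diag_mx D) 0 k by rewrite mul_mx_diag mxE.
  by rewrite E mxE.
have cn : (one *m one^t*) 0 0 = n%:R.
  rewrite mxE (eq_bigr (fun _ => 1)); last by move=> k _; rewrite !mxE conjC1 mulr1.
  by rewrite sumr_const card_ord.
have [k0 ck0] : exists k0, c 0 k0 != 0.
  apply/existsP; apply: contraT; rewrite negb_exists => /forallP H.
  move: cn; rewrite dotE big1 => [/eqP|k _].
    by rewrite eq_sym pnatr_eq0 eqn0Ngt n0.
  by move: (H k); rewrite negbK => /eqP; rewrite /c => ->; rewrite mul0r.
have Dk0 : D 0 k0 = d by apply: (mulfI ck0); rewrite cD mulrC.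
(* The strict inequality [lam < d] makes the eigenvalue [d] occur at [k0] only, so all other
   coordinates carry eigenvalues from [s]. *)
have ds : d \notin s.
  apply/negP => /sl; rewrite ger0_norm ?(le_trans l0 (ltW ld)) //.
  by move=> h; have := lt_le_trans ld h; rewrite ltxx.
have Ds k : k != k0 -> D 0 k \in s.
  move=> kk0; apply: (@prod_XsubC_at_most_one _ _ (fun k => D 0 k) mu s k0 k) => //.
    rewrite -cA AE char_poly_conj // char_poly_trig ?diag_mx_is_trig //.
    by apply: eq_bigr => i _; rewrite !mxE eqxx mulr1n.
  by rewrite Dk0.
have ck k : k != k0 -> c 0 k = 0.
  move=> kk0; apply/eqP; apply: contraT => c0; case/negP: ds.
  have <- : D 0 k = d by apply: (mulfI c0); rewrite cD mulrC.
  exact: Ds.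
have one_dot w : (w *m one^t*) 0 0 = cf w 0 k0 * (c 0 k0)^*.
  rewrite dotE (bigD1 k0) //= big1 ?addr0 // => k /ck.
  by rewrite /c => ->; rewrite conjC0 mulr0.
have ck0n : c 0 k0 * (c 0 k0)^* = n%:R by rewrite -one_dot.
have nn0 : (n%:R : C) != 0 by rewrite pnatr_eq0 -lt0n.
rewrite -/one !one_dot formE (bigD1 k0) //= Dk0.
(* The subtracted main term is exactly the [k0] summand of the form, because [c 0 k0] has squared
   modulus [n]. *)
have -> : d * (cf u 0 k0 * (c 0 k0)^*) * (cf v 0 k0 * (c 0 k0)^*)^* / n%:R =
    d * (cf u 0 k0 * (cf v 0 k0)^*).
  rewrite rmorphM /= conjCK -[X in _ / X]ck0n.
  have cc : (c 0 k0)^* != 0 by rewrite conjC_eq0.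
  by field; rewrite ck0 cc.
rewrite addrAC subrr add0r.
apply: (le_trans (ler_norm_sum _ _ _)).
pose bnd k :=
  lam / 2 * (t * (cf u 0 k * (cf u 0 k)^*) + cf v 0 k * (cf v 0 k)^* / t).
have bnd0 k : 0 <= bnd k.
  rewrite mulr_ge0 ?divr_ge0 ?ler0n // addr_ge0 //.
    by rewrite mulr_ge0 ?mul_conjC_ge0 // ltW.
  by rewrite divr_ge0 ?mul_conjC_ge0 // ltW.
have key k : k != k0 -> `|D 0 k * (cf u 0 k * (cf v 0 k)^*)| <= bnd k.
  move=> /Ds /sl Dl; rewrite /bnd !normrM norm_conjC -!normCK.
  apply: (le_trans (ler_wpM2r _ Dl)); first by rewrite mulr_ge0.
  rewrite -mulrA ler_wpM2l //.
  set p := `|_|; set q := `|_|.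
  have pr : p \is Num.real by rewrite normr_real.
  have qr : q \is Num.real by rewrite normr_real.
  have tn0 : t != 0 by rewrite gt_eqF.
  rewrite -subr_ge0.
  have -> : 2^-1 * (t * p ^+ 2 + q ^+ 2 / t) - p * q = (t * p - q) ^+ 2 / (2 * t).
    by field; rewrite tn0.
  apply: divr_ge0; last by rewrite mulr_ge0 ?ler0n // ltW.
  rewrite -realEsqr.
  by rewrite rpredB // rpredM // ger0_real // ltW.
apply: (le_trans (ler_sum _ key)).
rewrite !dotE mulr_sumr mulr_suml -big_split /= mulr_sumr.
by rewrite [leRHS](bigD1 k0) //= lerDr bnd0.
Qed.

(** The eigenbasis is taken over [R[i]]: the real factorisation of the characteristic polynomial is
    mapped there, sets become 0-1 row vectors, and the final inequality is pulled back along the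
    embedding. *)
Lemma expander_mixing (R : realType) (n : nat) (G : rel 'I_n) (d : nat) (lam : R) :
  ndl_graph G d lam -> 0 <= lam -> lam < d%:R -> (0 < n)%N -> mixing G d%:R lam.
Proof.
move=> [[Gs _] [Gd [mu [s [cA [_ sl]]]]]] l0 ld n0 X Y t t0; rewrite card_ord.
pose toC : {rmorphism R -> R[i]} := real_complex R.
have le_toC x y : (toC x <= toC y) = (x <= y) := lecR x y.
have lt_toC x y : (toC x < toC y) = (x < y) := ltcR x y.
have norm_toC x : `|toC x| = toC `|x|.
  by rewrite normc_def /= expr0n addr0 sqrtr_sqr.
pose A : 'M[R[i]]_n := adj_mx _ G.
pose ind (Z : {set 'I_n}) : 'rV[R[i]]_n := \row_j (j \in Z)%:R.
have AE : A = map_mx toC (adj_mx R G).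
  by apply/matrixP => i j; rewrite !mxE rmorph_nat.
have Ah : A \is hermsymmx.
  apply/is_hermitianmxP; rewrite expr0 scale1r; apply/matrixP => i j.
  by rewrite !mxE conjC_nat Gs.
have A1 : const_mx 1 *m A = d%:R *: (const_mx 1 : 'rV[R[i]]_n).
  apply/rowP => j; rewrite !mxE mulr1 -(Gd j) -sum1_card natr_sum [RHS]big_mkcond /=.
  by apply: eq_bigr => i _; rewrite !mxE mul1r inE Gs; case: (G j i).
have cA' : char_poly A = ('X - (toC mu)%:P) * \prod_(x <- map toC s) ('X - x%:P).
  by rewrite AE -map_char_poly cA rmorphM /= map_polyXsubC prod_map_poly.
have sl' x : x \in map toC s -> `|x| <= toC lam.
  by move=> /mapP[y ys ->]; rewrite norm_toC le_toC; exact: sl.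
have dotE (Z1 Z2 : {set 'I_n}) : (ind Z1 *m (ind Z2)^t*) 0 0 = #|Z1 :&: Z2|%:R.
  rewrite mxE -sum1_card natr_sum [RHS]big_mkcond; apply: eq_bigr => k _.
  by rewrite !mxE conjC_nat inE -natrM mulnb; case: (_ && _).
have setTE : const_mx 1 = ind [set: 'I_n].
  by apply/rowP => j; rewrite !mxE inE.
have dT : (d%:R : R[i]) = toC d%:R by rewrite rmorph_nat.
have formE : (ind X *m A *m (ind Y)^t*) 0 0 = (edges G X Y)%:R.
  rewrite -mulmxA mxE /edges natr_sum [RHS]big_mkcond /=; apply: eq_bigr => i _.
  rewrite !mxE; case: (i \in X); last by rewrite mul0r.
  rewrite mul1r /nbrs_in -sum1_card natr_sum [RHS]big_mkcond /=; apply: eq_bigr => j _.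
  by rewrite !mxE conjC_nat inE -natrM mulnb andbC; case: (_ && _).
have := @hermitian_mixing R[i] n A d%:R (toC lam) (toC mu)
  (map toC s) (ind X) (ind Y) (toC t)
  n0 Ah A1 cA' sl'.
rewrite dT -(rmorph0 toC) !lt_toC le_toC => /(_ l0 ld t0).
rewrite setTE !dotE formE !finset.setIT !finset.setIid conjC_nat.
have E2 : (2 : R[i]) = toC 2 by rewrite rmorph_nat.
rewrite E2 -!(rmorph_nat toC) -!(fmorphV toC) -!(rmorphM toC) -!(rmorphD toC) -!(rmorphB toC) /=.
by rewrite norm_toC -(rmorphM toC) le_toC.
Qed.

(** With at least two vertices the characteristic polynomial has degree above one, so [s] is
    nonempty and [lam] bounds an absolute value. *)
Lemma ndl_graph_lam_ge0 (R : realType) (n : nat) (G : rel 'I_n) (d : nat) (lam : R) :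
  ndl_graph G d lam -> (1 < n)%N -> 0 <= lam.
Proof.
move=> [_ [_ [mu [s [cA [_ sl]]]]]] n1.
case: s cA sl => [|x s] cA sl; last first.
  by apply: le_trans (sl x (mem_head _ _)).
have := size_char_poly (adj_mx R G); rewrite cA big_nil mulr1 size_XsubC.
by case: n n1 {G cA} => [|[]].
Qed.

(** * Asymptotics *)

Lemma expR_nat_le4 (R : realType) (k : nat) : expR k%:R <= (4 ^ k)%:R :> R.
Proof.
have e4 : expR 1 <= 4 :> R.
  (* From [1 + x <= expR x] at [x = - 1 / 2]; inverting gives [expR (1 / 2) <= 2], and squaring
     gives the bound 4. *)
  have h : 2^-1 <= expR (- 2^-1) :> R by apply: le_trans (expR_ge1Dx _); lra.
  have -> : (1 : R) = 2^-1 + 2^-1 by lra.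
  rewrite expRD; rewrite expRN in h.
  have p : 0 < expR 2^-1 :> R := expR_gt0 _.
  have h2 : expR 2^-1 <= 2 :> R.
    by have := ler_wpM2r (ltW p) h; rewrite mulVf ?gt_eqF //; lra.
  apply: le_trans (_ : 2 * 2 <= _); last by lra.
  by apply: ler_pM => //; apply: ltW.
by rewrite -[k%:R]mulr1 expRM_natl natrX lerXn2r // nnegrE ?expR_ge0.
Qed.

Lemma ln_le_powR (R : realType) (x eps : R) : 0 < eps -> 0 < x -> ln x <= x `^ eps / eps.
Proof.
move=> e0 x0; rewrite ler_pdivlMr // mulrC -ln_powR.
by apply: ltW; apply: ln_sublinear; apply: powR_gt0.
Qed.

Lemma powR_gap (R : realType) (n d : nat) (eps eta : R) :
  (0 < n)%N -> 0 < eta -> d%:R <= eta * (n%:R `^ (2^-1 - eps)) ->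
  d%:R ^+ 2 * (n%:R `^ eps) ^+ 2 <= eta ^+ 2 * n%:R.
Proof.
move=> n0 e0 dn.
have nR : 0 < n%:R :> R by rewrite ltr0n.
rewrite -exprMn.
have -> : eta ^+ 2 * n%:R = (eta * n%:R `^ 2^-1) ^+ 2.
  by rewrite exprMn powR12_sqrt ?ler0n // sqr_sqrtr ?ler0n.
have u0 : 0 < n%:R `^ eps by apply: powR_gt0.
rewrite lerXn2r ?nnegrE ?mulr_ge0 ?powR_ge0 ?ler0n ?(ltW e0) //.
apply: le_trans (ler_wpM2r (ltW u0) dn) _.
rewrite -mulrA -powRD; last by rewrite (gt_eqF nR) implybT.
by rewrite subrK.
Qed.

Lemma eventually_powR_ge (R : realType) (eps K : R) : 0 < eps ->
  exists N : nat, forall n : nat, (N <= n)%N -> K <= n%:R `^ eps.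
Proof.
move=> e0; pose K' := Num.max 1 K.
have K1 : 1 <= K' by rewrite le_max lexx.
have K0 : 0 <= K' by lra.
exists (Num.truncn (K' `^ eps^-1)).+1 => n Nn.
have nK : K' `^ eps^-1 <= n%:R.
  by apply: le_trans (_ : (Num.truncn (K' `^ eps^-1)).+1%:R <= _);
    rewrite ?ler_nat // ltW // truncnS_gt.
apply: le_trans (_ : K' <= _); first by rewrite le_max lexx orbT.
have -> : K' = (K' `^ eps^-1) `^ eps by rewrite -powRrM mulVf ?gt_eqF // powRr1.
by apply: ge0_ler_powR; rewrite ?nnegrE ?powR_ge0 ?ler0n // ltW.
Qed.

(* With [u = n^eps], [d^2 u^2 <= eta^2 n] and [k <= u / eps + 1], so [d^2 k = o(n)]. *)
Lemma eventually_parameters (R : realType) (eps eta : R) :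
  0 < eps -> 0 < eta -> eta < 2^-1 ->
  exists N : nat, forall n : nat, (N <= n)%N -> forall d : nat,
    (0 < d)%N -> d%:R <= eta * (n%:R `^ (2^-1 - eps)) ->
    exists k j : nat,
    [/\ Num.ceil (ln (eta ^+ 2 * n%:R / 4096)) = k%:Z :> int,
        (512 <= n)%N, 128 * d%:R ^+ 2 <= eta * n%:R,
        (j <= k.+1)%N /\ eta ^+ 2 / 2048 * n%:R <= (4 ^ j)%:R &
        (d * d * (2 * k + 3) + (2 * k + 3 + 4 * 4 ^ j) <= 60 * (n %/ 512))%N].
Proof.
move=> e0 h0 h1.
(* The constant makes [u ^ 2] at least 128 and [4 * u ^ 2] at least [80 * u / eps + 200]. *)
have [N1 N1P] := eventually_powR_ge (64 + 50 * (eps^-1 + 3)) e0.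
pose N2 := (Num.truncn (2000 + 4096 / eta ^+ 2)).+1.
exists (maxn N1 N2) => n; rewrite geq_max => /andP[n1 n2] d d0 dn.
have hh0 : 0 < eta ^+ 2 by rewrite exprn_gt0.
have nN2 : 2000 + 4096 / eta ^+ 2 <= n%:R.
  by apply: le_trans (_ : N2%:R <= _); rewrite ?ler_nat // ltW // truncnS_gt.
have := N1P n n1; clear N1P n1 n2 N2 N1; set u := n%:R `^ eps => uK.
have q0 : 0 <= 4096 / eta ^+ 2 by apply: divr_ge0; [exact: ler0n|exact: ltW].
have nR : 2000 <= n%:R :> R by move: nN2 q0; clear; lra.
have n0 : (0 < n)%N by rewrite -(ltr0n R); move: nR; clear; lra.
have hh1 : eta ^+ 2 <= 1 / 4 by move: h0 h1; clear; nra.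
have := powR_gap n0 h0 dn; rewrite -/u => gap.
have ie0 : 0 < eps^-1 by rewrite invr_gt0.
have dR : 1 <= d%:R :> R by rewrite ler1n.
pose x := eta ^+ 2 * n%:R / 4096.
(* This makes [ln x] nonnegative, so that its ceiling is a natural number [k]. *)
have x1 : 1 <= x.
  have : 4096 / eta ^+ 2 <= n%:R by move: nN2; clear; lra.
  by rewrite /x ler_pdivrMr // ler_pdivlMr ?ltr0n // mul1r mulrC.
have c0 : 0 <= Num.ceil (ln x) by rewrite -(ler_int R) (le_trans (ln_ge0 x1)) // ceil_ge.
have [k kE] : exists k : nat, Num.ceil (ln x) = k%:Z.
  by exists `|Num.ceil (ln x)|%N; rewrite gez0_abs.
have /andP[k1 k2] := ceil_itv (ln x); rewrite kE in k1 k2.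
have xn : ln x <= u / eps.
  apply: le_trans (_ : ln n%:R <= _); last by apply: ln_le_powR; rewrite ?ltr0n.
  rewrite ler_ln ?posrE ?(lt_le_trans ltr01 x1) ?ltr0n // /x.
  have : eta ^+ 2 * n%:R <= 1 / 4 * n%:R by rewrite ler_wpM2r // ler0n.
  by move: nR; clear; lra.
have kR : k%:R <= u / eps + 1.
  by move: k1 xn; rewrite intrB -[k%:~R]/(k%:R); clear; lra.
have x4k : x <= (4 ^ k)%:R.
  rewrite -[x]lnK ?posrE ?(lt_le_trans ltr01 x1) //.
  by apply: le_trans (expR_nat_le4 _ k); rewrite ler_expR.
have jk1 : eta ^+ 2 / 2048 * n%:R <= (4 ^ k.+1)%:R :> R.
  by rewrite expnS natrM; move: x4k x1; rewrite /x; clear; lra.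
have exj : exists j, eta ^+ 2 / 2048 * n%:R <= (4 ^ j)%:R :> R by exists k.+1.
case: (ex_minnP exj) => j jP jmin.
have D1 : 1 <= d%:R ^+ 2 :> R by rewrite expr_ge1 // ler0n.
exists k, j; split=> //.
- by rewrite -(ler_nat R); move: nR; clear; lra.
- have : d%:R ^+ 2 * 128 <= d%:R ^+ 2 * u ^+ 2.
    by rewrite ler_wpM2l ?sqr_ge0 //; move: uK ie0; clear; nra.
  have : eta ^+ 2 * n%:R <= eta * n%:R.
    by rewrite ler_wpM2r ?ler0n //; move: h0 h1; clear; nra.
  by move: gap; clear; lra.
- by split=> //; apply: jmin.
(* Minimality of [j] bounds [4 * 4 ^ j] by 16 times the threshold [eta ^ 2 * n / 2048], at most
   [n / 512]; the summand 4 covers [j = 0]. *)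
have j4 : (4 * 4 ^ j)%:R <= n%:R / 512 + 4 :> R.
  case: j jP jmin => [|j] jP jmin; first by rewrite expn0 muln1; move: nR; clear; lra.
  have : (4 ^ j)%:R < eta ^+ 2 / 2048 * n%:R :> R.
    by rewrite ltNge; apply/negP => /jmin; rewrite ltnn.
  have : eta ^+ 2 * n%:R <= 1 / 4 * n%:R by rewrite ler_wpM2r // ler0n.
  by rewrite expnS !natrM; clear; lra.
have q1 : n%:R <= 512 * ((n %/ 512)%:R + 1) :> R.
  have := ltn_ceil n (isT : 0 < 512)%N => /ltnW.
  by rewrite -(ler_nat R) natrM -natr1; clear; lra.
(* The left side is 20 times [d ^ 2 * (4 * u / eps + 10)], which bounds the path terms of the
   budget; they take at most [n / 20] of roughly [60 * n / 512]. *)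
have big : d%:R ^+ 2 * (80 * (u * eps^-1) + 200) <= n%:R.
  apply: le_trans (_ : d%:R ^+ 2 * (4 * u ^+ 2) <= _).
    rewrite ler_wpM2l ?sqr_ge0 //.
    have u0 : 0 <= u by move: uK ie0; clear; lra.
    have := ler_wpM2l u0 uK; have : 0 <= u * eps^-1 by rewrite mulr_ge0 // ltW.
    by move: uK ie0; clear; rewrite expr2; lra.
  have : eta ^+ 2 * n%:R <= 1 / 4 * n%:R by rewrite ler_wpM2r // ler0n.
  by move: gap; clear; lra.
have kD : 2 * k%:R + 3 <= d%:R ^+ 2 * (2 * k%:R + 3) :> R.
  by rewrite ler_peMl // addr_ge0 // mulr_ge0 // ler0n.
have kD2 : d%:R ^+ 2 * (2 * k%:R + 3) <= d%:R ^+ 2 * (2 * (u / eps) + 5).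
  by rewrite ler_wpM2l ?sqr_ge0 //; move: kR; clear; lra.
rewrite -(ler_nat R) !natrD !natrM natrD natrM -expr2 -natrM.
by move: kD kD2 big q1 j4 nR; clear; lra.
Qed.

Theorem theorem3 (R : realType) (eps eta : R) :
  0 < eps -> 0 < eta -> eta < 2^-1 ->
  exists N : nat, forall n : nat, (N <= n)%N ->
    forall (G : rel 'I_n) (d : nat) (lam : R),
      ndl_graph G d lam ->
      2048 * lam / eta ^+ 2 < d%:R ->
      d%:R <= eta * (n%:R `^ (2^-1 - eps)) ->
      has_Kl_subdivision G (Num.truncn ((1 - eta) * d%:R))
        (absz (2 * Num.ceil (ln (eta ^+ 2 * n%:R / 4096)) + 5)%R).
Proof.
move=> e0 h0 h1; have [N NP] := eventually_parameters e0 h0 h1.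
(* At least two vertices are needed for [lam >= 0], from which [d > 0] and [lam < d] follow. *)
exists (maxn N 2) => n; rewrite geq_max => /andP[Nn n2] G d lam ndl lam_d dn.
have l0 := ndl_graph_lam_ge0 ndl n2.
have hh0 : 0 < eta ^+ 2 by rewrite exprn_gt0.
have l1 : lam < eta ^+ 2 * d%:R / 2048.
  by move: lam_d; rewrite ltr_pdivrMr //; clear; lra.
have d0 : (0 < d)%N.
  rewrite -(ltr0n R); apply: le_lt_trans lam_d.
  exact: divr_ge0 (mulr_ge0 (ler0n _ _) l0) (ltW hh0).
have ld : lam < d%:R.
  have : eta ^+ 2 * d%:R <= 1 * d%:R.
    by rewrite ler_wpM2r ?ler0n // expr_le1 ?(ltW h0) //; move: h1; clear; lra.
  have : 0 < d%:R :> R by rewrite ltr0n.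
  by move: l1; clear; lra.
have mix := expander_mixing ndl l0 ld (ltnW n2).
have [k [j [-> n512 d128 [jk jn] bud]]] := NP n Nn d d0 dn.
have -> : absz (2 * k%:Z + 5)%R = (2 * k + 5)%N by [].
have [[Gs Gi] [Gd _]] := ndl.
rewrite -[n in (512 <= n)%N]card_ord in n512.
apply: (subdivision_of_mixing Gs Gi Gd mix h0 h1 l0 l1 d0 _ _ jk) => //.
- by rewrite card_ord.
- by rewrite truncn_le mulr_ge0 ?ler0n //; move: h1; clear; lra.
- by rewrite card_ord.
by rewrite card_ord.
Qed.
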